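(* Let $\mu$ be a complex number with $2\mu\notin\mathbb{Z}$ and let $x>0$. Let $\frac{\partial \mathrm{W}_{\kappa,\pm\mu}(x)}{\partial\mu}$ denote the partial derivative of $\mathrm{W}_{\kappa,\nu}(x)$ with respect to its second parameter $\nu$, evaluated at $\nu=\pm\mu$. Then $$\left.\frac{\partial \mathrm{W}_{\kappa,\pm\mu}(x)}{\partial\mu}\right|_{\kappa=\mu+1/2}=\pm\sqrt{x}\,e^{-x/2}\left\{x^{\mu}\left[\frac{x}{2\mu+1}\,{}_2F_2\left(\left.\begin{array}{c}1,1\\ 2\mu+2,2\end{array}\right|x\right)-\psi(-2\mu)+\ln x\right]-\Gamma(2\mu+1)\,x^{-\mu}(-x)^{2\mu}\gamma(-2\mu,-x)\right\},$$ where the same sign is taken on both sides.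
   Context: For $x>0$ and complex $\kappa,\mu$, the Whittaker function is $\mathrm{W}_{\kappa,\mu}(x)=e^{-x/2}x^{\mu+1/2}\,\mathrm{U}\left(\frac12+\mu-\kappa,1+2\mu,x\right)$, where $\mathrm{U}$ is the Tricomi confluent hypergeometric function. The generalized hypergeometric function is ${}_pF_q\left(\left.\begin{array}{c}a_1,\ldots,a_p\\ b_1,\ldots,b_q\end{array}\right|x\right)=\sum_{n\ge0}\frac{(a_1)_n\cdots(a_p)_n}{(b_1)_n\cdots(b_q)_n}\frac{x^n}{n!}$ with $(\alpha)_n=\Gamma(\alpha+n)/\Gamma(\alpha)$. $\psi=\Gamma'/\Gamma$ is the digamma function. The lower incomplete gamma function is $\gamma(\nu,z)=\int_0^z t^{\nu-1}e^{-t}\,dt$ for $\mathrm{Re}\,\nu>0$, continued analytically in $\nu\neq0,-1,-2,\ldots$ by $\gamma(\nu,z)=\sum_{n\ge0}\frac{(-1)^n z^{\nu+n}}{n!(\nu+n)}$; powers are principal, with $\arg(-x)=\pi$ for $x>0$. *)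

(* Defs.v *)
From Stdlib Require Export Reals ZArith List ClassicalEpsilon.
From Coquelicot Require Export Coquelicot.
Export ListNotations.

Local Open Scope C_scope.

(** The limit of a sequence, the sum of a series and the limit at a point, in
    the complex numbers.  [iota] selects the unique element satisfying a
    predicate; the value is arbitrary when the limit does not exist. *)
Definition Climseq (u : nat -> C) : C :=
  @iota C_CompleteNormedModule (fun l : C => filterlim u eventually (@locally C_UniformSpace l)).

Definition Cseries (u : nat -> C) : C :=
  @iota C_CompleteNormedModule (fun l : C => is_series (V := C_NormedModule) u l).

Definition Climit (f : C -> C) (z : C) : C :=
  @iota C_CompleteNormedModule (fun l : C => filterlim f (@locally' C_UniformSpace z) (@locally C_UniformSpace l)).

Definition Cexp (z : C) : C :=
  RtoC (exp (Re z)) * (cos (Im z), sin (Im z)).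

(** Principal argument, with values in (-PI, PI]; it is PI on the negative real
    axis. *)
Definition Carg (z : C) : R :=
  if Rle_dec 0 (Im z) then acos (Re z / Cmod z) else (- acos (Re z / Cmod z))%R.

Definition Clog (z : C) : C := (ln (Cmod z), Carg z).

(** Principal power; only meaningful for [z <> 0]. *)
Definition Cpower (z w : C) : C := Cexp (w * Clog z).

Definition is_Cint (z : C) : Prop := exists k : Z, z = RtoC (IZR k).

(** The product [(a)_n = a (a+1) ... (a+n-1)].  It is [Gamma (a+n) / Gamma a]
    when [a] is not a pole of [Gamma], and the continuous extension of this
    quotient at the poles [a = 0, -1, -2, ...], which do occur below in
    [kummerM a b z]. *)
Fixpoint poch (a : C) (n : nat) : C :=
  match n with
  | O => RtoC 1
  | S m => poch a m * (a + RtoC (INR m))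
  end.

(** The entire function 1/Gamma, by Euler's limit
    [Gamma z = lim n! n^z / (z (z+1) ... (z+n))]. *)
Definition rGamma (z : C) : C :=
  Climseq (fun n => poch z (S n)
                    / (RtoC (INR (fact n)) * Cpower (RtoC (INR n)) z)).

Definition Gamma (z : C) : C := / rGamma z.

Definition digamma (z : C) : C := C_derive Gamma z / Gamma z.

Definition pochs (a : list C) (n : nat) : C :=
  fold_right Cmult (RtoC 1) (map (fun c => poch c n) a).

(** Generalized hypergeometric series, with upper parameters [a] and lower
    parameters [b]. *)
Definition pFq (a b : list C) (z : C) : C :=
  Cseries (fun n => pochs a n / pochs b n
                    * (Cpow z n / RtoC (INR (fact n)))).

Definition kummerM (a b z : C) : C := pFq [a] [b] z.

(** Tricomi's function for [b] not an integer.  The quotients by [Gamma] are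
    written with [rGamma], which vanishes at the poles of [Gamma]. *)
Definition tricomiU_nonint (a b z : C) : C :=
  Gamma (RtoC 1 - b) * rGamma (a - b + RtoC 1) * kummerM a b z
  + Gamma (b - RtoC 1) * rGamma a * Cpower z (RtoC 1 - b)
    * kummerM (a - b + RtoC 1) (RtoC 2 - b) z.

(** At integers [b] it is defined by continuity in [b]. *)
Definition tricomiU (a b z : C) : C :=
  if excluded_middle_informative (is_Cint b)
  then Climit (fun b' => tricomiU_nonint a b' z) b
  else tricomiU_nonint a b z.

(** The Whittaker function W with parameters [kappa], [mu], for [0 < x]. *)
Definition whittakerW (kappa mu : C) (x : R) : C :=
  RtoC (exp (- x / 2)) * Cpower (RtoC x) (mu + RtoC (1 / 2))
  * tricomiU (RtoC (1 / 2) + mu - kappa) (RtoC 1 + RtoC 2 * mu) (RtoC x).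

(** Lower incomplete gamma function, [nu] not in {0, -1, -2, ...}, by the series
    that continues [int_0^z t^(nu-1) e^(-t) dt] beyond [0 < Re nu]. *)
Definition lower_gamma (nu z : C) : C :=
  Cseries (fun n => Cpow (RtoC (-1)) n * Cpower z (nu + RtoC (INR n))
                    / (RtoC (INR (fact n)) * (nu + RtoC (INR n)))).

(* Main.v *)
(** Put kappa = mu + 1/2. For nu near +mu or -mu the connection formula for U gives
    W = sqrt x e^(-x/2) (F nu + F (-nu)) with
    F nu = x^nu Gamma(-2 nu) / Gamma(-nu-mu) M(nu-mu, 1+2 nu, x).
    At nu = mu the upper parameter of M vanishes: M = 1 + (nu-mu) S nu, where S mu is the
    2F2 series, and the Gamma quotient has logarithmic derivative -psi(-2 mu).
    At nu = -mu the factor 1/Gamma(-nu-mu) has a simple zero, so F'(-mu) only involves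
    M(-2 mu, 1-2 mu, x), which is the incomplete gamma series.
    Holomorphy of 1/Gamma comes from Euler's product: consecutive approximants differ by
    a factor 1 + O(1/m^2), uniformly and in Lipschitz norm on discs, and dominated
    convergence of the slopes at a point gives the derivative there. *)

Require Import Defs.
From Stdlib Require Import Lra Lia FunctionalExtensionality.

Local Open Scope C_scope.

(** * Limits and complex derivatives *)

(** No contour integral enters, so a bound on a family of holomorphic functions does not yield one
    on their derivatives. This is why every size estimate for Euler's approximants is paired with a
    Lipschitz estimate. The derivatives of [M] in its parameters are never computed: at [mu] the
    cofactor of the vanishing upper parameter only has to be continuous, and at [- mu] so does
    everything that multiplies the zero of [1/Gamma]. Joint continuity of Kummer-type series in
    their parameters is therefore enough. [Gamma] is a formal reciprocal, so [Gamma] and [digamma]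
    are meaningful only where [rGamma] is nonzero; this is proved from the product itself. The
    derivative of [rGamma] stays an unnamed number that also defines [digamma]; its value is
    computed only at 0. The brace in the statement is [F'(mu) - F'(-mu)], and the sign in front
    reflects that [F nu + F (-nu)] is even. The branch of [(-x)^w] matters little: [(-x)^(2 mu)]
    cancels the power [(-x)^(-2 mu)] contained in the incomplete gamma function. *)

Definition Clim {T : Type} (F : (T -> Prop) -> Prop) (f : T -> C) (l : C) : Prop :=
  filterlim f F (@locally C_UniformSpace l).

(* Balls for [Cmod], the topology behind [is_derive] on [C_AbsRing]; the canonical
   uniform space on [C] is instead the product one. *)
Definition nbhd (z : C) : (C -> Prop) -> Prop :=
  @locally (AbsRing_UniformSpace C_AbsRing) z.

Lemma nbhd_intro (z : C) (d : R) (P : C -> Prop) :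
  (0 < d)%R -> (forall w, (Cmod (w - z) < d)%R -> P w) -> nbhd z P.
Proof. intros Hd H. exists (mkposreal d Hd). intros w Hw. apply H. exact Hw. Qed.

Lemma nbhd_elim (z : C) (P : C -> Prop) :
  nbhd z P -> exists d, (0 < d)%R /\ forall w, (Cmod (w - z) < d)%R -> P w.
Proof.
  intros [d H]. exists d. split. apply cond_pos. intros w Hw. apply H. exact Hw.
Qed.

#[local] Instance nbhd_filter (z : C) : ProperFilter (nbhd z).
Proof. exact (@locally_filter (AbsRing_UniformSpace C_AbsRing) z). Qed.

(** The product topology and the modulus topology on [C] have the same neighbourhoods. Limits are
    reduced here once and for all to estimates on [Cmod]. *)
Lemma Clim_eps {T : Type} (F : (T -> Prop) -> Prop) {FF : Filter F}
  (f : T -> C) (l : C) :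
  Clim F f l <-> forall eps, (0 < eps)%R -> F (fun t => (Cmod (f t - l) < eps)%R).
Proof.
  split.
  - intros H eps He.
    apply (H (fun w => (Cmod (w - l) < eps)%R)).
    apply (@locally_le_locally_norm C_AbsRing C_NormedModule l).
    exists (mkposreal eps He). intros y Hy. exact Hy.
  - intros H P HP.
    apply (@locally_norm_le_locally C_AbsRing C_NormedModule l) in HP.
    destruct HP as [e HP].
    unfold filtermap. generalize (H e (cond_pos e)). apply filter_imp.
    intros t Ht. apply HP. exact Ht.
Qed.

Section Limits.
Context {T : Type} {F : (T -> Prop) -> Prop} {FF : Filter F}.

Lemma Clim_const (c : C) : Clim F (fun _ => c) c.
Proof. apply filterlim_const. Qed.

Lemma Clim_ext_loc (f g : T -> C) (l : C) :
  F (fun t => f t = g t) -> Clim F f l -> Clim F g l.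
Proof. apply filterlim_ext_loc. Qed.

Lemma Clim_eq (f : T -> C) (l m : C) : l = m -> Clim F f l -> Clim F f m.
Proof. now intros ->. Qed.

Lemma Clim_plus (f g : T -> C) (l m : C) :
  Clim F f l -> Clim F g m -> Clim F (fun t => f t + g t) (l + m).
Proof.
  rewrite !(Clim_eps F). intros Hf Hg eps He.
  assert (He2 : (0 < eps / 2)%R) by lra.
  generalize (filter_and _ _ (Hf _ He2) (Hg _ He2)). apply filter_imp.
  intros t [H1 H2].
  replace (f t + g t - (l + m)) with ((f t - l) + (g t - m)) by ring.
  eapply Rle_lt_trans. apply Cmod_triangle. lra.
Qed.

Lemma Clim_mult (f g : T -> C) (l m : C) :
  Clim F f l -> Clim F g m -> Clim F (fun t => f t * g t) (l * m).
Proof.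
  rewrite !(Clim_eps F). intros Hf Hg eps He.
  pose (A := (Cmod l + Cmod m + 1)%R).
  assert (HA : (1 <= A)%R).
  { unfold A. pose proof (Cmod_ge_0 l). pose proof (Cmod_ge_0 m). lra. }
  (* With both errors below [d <= 1], the quadratic error term is at most [d], so the total is at
     most [d * A <= eps / 2]. *)
  pose (d := Rmin 1 (eps / (2 * A))).
  assert (Hd : (0 < d)%R).
  { apply Rmin_pos. lra. apply Rdiv_lt_0_compat; lra. }
  generalize (filter_and _ _ (Hf _ Hd) (Hg _ Hd)). apply filter_imp.
  intros t [H1 H2].
  replace (f t * g t - l * m)
    with ((f t - l) * (g t - m) + (l * (g t - m) + m * (f t - l))) by ring.
  eapply Rle_lt_trans. apply Cmod_triangle.
  eapply Rle_lt_trans. apply Rplus_le_compat_l. apply Cmod_triangle.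
  rewrite !Cmod_mult.
  assert (d <= 1)%R by apply Rmin_l.
  assert (d * A <= eps / 2)%R.
  { apply Rle_trans with (eps / (2 * A) * A)%R.
    - apply Rmult_le_compat_r. lra. apply Rmin_r.
    - right. field. lra. }
  pose proof (Cmod_ge_0 l). pose proof (Cmod_ge_0 m).
  pose proof (Cmod_ge_0 (f t - l)). pose proof (Cmod_ge_0 (g t - m)).
  unfold A in *. nra.
Qed.

Lemma Clim_opp (f : T -> C) (l : C) : Clim F f l -> Clim F (fun t => - f t) (- l).
Proof.
  intros H. replace (- l) with (- (1) * l) by ring.
  apply (Clim_ext_loc (fun t => - (1) * f t)).
  - apply filter_forall. intros t. ring.
  - apply Clim_mult; [apply Clim_const | exact H].
Qed.

Lemma Clim_minus (f g : T -> C) (l m : C) :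
  Clim F f l -> Clim F g m -> Clim F (fun t => f t - g t) (l - m).
Proof. intros Hf Hg. apply Clim_plus; [exact Hf | apply Clim_opp, Hg]. Qed.

Lemma Clim_neq_0 (f : T -> C) (l : C) :
  l <> 0 -> Clim F f l -> F (fun t => f t <> 0).
Proof.
  intros Hl. rewrite (Clim_eps F). intros Hf.
  generalize (Hf (Cmod l) (proj1 (Cmod_gt_0 l) Hl)). apply filter_imp.
  intros t Ht E. rewrite E in Ht.
  replace (0 - l) with (- l) in Ht by ring. rewrite Cmod_opp in Ht. lra.
Qed.

Lemma Clim_inv (f : T -> C) (l : C) :
  l <> 0 -> Clim F f l -> Clim F (fun t => / f t) (/ l).
Proof.
  intros Hl Hf. pose proof (Clim_neq_0 f l Hl Hf) as Hnz.
  revert Hf. rewrite !(Clim_eps F). intros Hf eps He.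
  assert (Hp : (0 < Cmod l)%R) by (apply Cmod_gt_0, Hl).
  (* The first bound keeps [Cmod (f t)] above [Cmod l / 2]; the second then absorbs the denominator
     [Cmod (f t) * Cmod l]. *)
  pose (d := Rmin (Cmod l / 2) (eps * Cmod l * Cmod l / 2)).
  assert (Hd : (0 < d)%R).
  { apply Rmin_pos. lra. apply Rdiv_lt_0_compat; try lra.
    repeat apply Rmult_lt_0_compat; lra. }
  generalize (filter_and _ _ Hnz (Hf _ Hd)). apply filter_imp.
  intros t [H1 H2].
  replace (/ f t - / l) with (- (f t - l) * (/ (f t * l))) by (field; split; auto).
  rewrite Cmod_mult, Cmod_opp, Cmod_inv, Cmod_mult by (apply Cmult_neq_0; auto).
  assert (d <= Cmod l / 2)%R by apply Rmin_l.
  assert (d <= eps * Cmod l * Cmod l / 2)%R by apply Rmin_r.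
  assert (Cmod l / 2 < Cmod (f t))%R.
  { assert (Cmod l <= Cmod (f t) + Cmod (f t - l))%R.
    { rewrite <- (Cmod_opp (f t - l)).
      replace l with (f t + - (f t - l)) at 1 by ring. apply Cmod_triangle. }
    lra. }
  assert (0 < Cmod (f t) * Cmod l)%R by (apply Rmult_lt_0_compat; lra).
  apply Rmult_lt_reg_r with (Cmod (f t) * Cmod l)%R; auto.
  rewrite Rmult_assoc, Rinv_l, Rmult_1_r by lra.
  assert (eps * Cmod l * (Cmod l / 2) < eps * Cmod l * Cmod (f t))%R.
  { apply Rmult_lt_compat_l; auto. apply Rmult_lt_0_compat; auto. }
  nra.
Qed.

End Limits.

Lemma Clim_Cmod_le {T : Type} {F : (T -> Prop) -> Prop} {FF : ProperFilter F}
  (f : T -> C) (l : C) (M : R) :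
  F (fun t => (Cmod (f t) <= M)%R) -> Clim F f l -> (Cmod l <= M)%R.
Proof.
  intros HM Hf. rewrite (Clim_eps F) in Hf.
  apply Rnot_lt_le. intros Hlt.
  assert (He : (0 < Cmod l - M)%R) by lra.
  destruct (filter_ex _ (filter_and _ _ HM (Hf _ He))) as [t [H1 H2]].
  assert (Cmod l <= Cmod (f t) + Cmod (f t - l))%R.
  { rewrite <- (Cmod_opp (f t - l)).
    replace l with (f t + - (f t - l)) at 1 by ring. apply Cmod_triangle. }
  lra.
Qed.

Lemma Clim_unique {T : Type} {F : (T -> Prop) -> Prop} {FF : ProperFilter F}
  (f : T -> C) (l m : C) : Clim F f l -> Clim F f m -> l = m.
Proof.
  apply (@filterlim_locally_unique T C_AbsRing C_NormedModule F
           (Proper_StrongProper _ FF)).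
Qed.

Lemma Climseq_unique (u : nat -> C) (l : C) : Clim eventually u l -> Climseq u = l.
Proof.
  intros H. unfold Climseq. apply (@iota_unique C_AbsRing C_CompleteNormedModule); [|exact H].
  intros y Hy. exact (Clim_unique u y l Hy H).
Qed.

(** * Complex series: comparison, tails and dominated convergence *)

Lemma Cseries_unique (a : nat -> C) (l : C) :
  is_series (V := C_NormedModule) a l -> Cseries a = l.
Proof.
  intros H. unfold Cseries. apply (@iota_unique C_AbsRing C_CompleteNormedModule); [|exact H].
  intros y Hy. exact (Clim_unique _ y l Hy H).
Qed.

(** Comparison with a convergent real series ensures that the sum selected by [iota] is a genuine
    one. *)
Lemma Cseries_correct (a : nat -> C) (M : nat -> R) :
  (forall n, (Cmod (a n) <= M n)%R) -> ex_series M ->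
  is_series (V := C_NormedModule) a (Cseries a).
Proof.
  intros Ha HM.
  destruct (@ex_series_le C_AbsRing C_CompleteNormedModule a M Ha HM) as [l Hl].
  rewrite (Cseries_unique a l Hl). exact Hl.
Qed.

Lemma Cseries_ext (a b : nat -> C) : (forall n, a n = b n) -> Cseries a = Cseries b.
Proof.
  intros H. f_equal. apply functional_extensionality. exact H.
Qed.

Lemma Csum_n_S (a : nat -> C) (n : nat) :
  sum_n (G := C_AbelianGroup) a (S n) = sum_n (G := C_AbelianGroup) a n + a (S n).
Proof. apply (@sum_Sn C_AbelianGroup). Qed.

Lemma sum_n_RS (a : nat -> R) (n : nat) : sum_n a (S n) = (sum_n a n + a (S n))%R.
Proof. apply (@sum_Sn R_AbelianGroup). Qed.

(** The termwise bound is summed over finite blocks after [N], then passed to the limit. The right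
    side depends on [M] alone, hence is uniform over a family of series. *)
Lemma Cseries_tail (a : nat -> C) (M : nat -> R) (N : nat) :
  (forall n, (Cmod (a n) <= M n)%R) -> ex_series M ->
  (Cmod (Cseries a - sum_n (G := C_AbelianGroup) a N) <= Series M - sum_n M N)%R.
Proof.
  intros Ha HM.
  pose proof (Cseries_correct a M Ha HM) as Hs.
  assert (Hk : forall k, (Cmod (sum_n (G := C_AbelianGroup) a (N + k)
                 - sum_n (G := C_AbelianGroup) a N) <= sum_n M (N + k) - sum_n M N)%R).
  { induction k as [|k IH].
    - rewrite Nat.add_0_r.
      replace (_ - _) with (RtoC 0) by ring. rewrite Cmod_0. lra.
    - rewrite Nat.add_succ_r, Csum_n_S, sum_n_RS.
      replace (sum_n (G := C_AbelianGroup) a (N + k) + a (S (N + k))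
               - sum_n (G := C_AbelianGroup) a N)
        with (sum_n (G := C_AbelianGroup) a (N + k)
               - sum_n (G := C_AbelianGroup) a N + a (S (N + k))) by ring.
      eapply Rle_trans. apply Cmod_triangle.
      specialize (Ha (S (N + k))). lra. }
  assert (Hinc : forall n, (sum_n M n <= Series M)%R).
  { intros n. apply (is_lim_seq_incr_compare (sum_n M)).
    - exact (Series_correct M HM).
    - intros m. rewrite sum_n_RS.
      pose proof (Cmod_ge_0 (a (S m))). specialize (Ha (S m)). lra. }
  apply (Clim_Cmod_le (F := eventually)
           (fun n => sum_n (G := C_AbelianGroup) a n - sum_n (G := C_AbelianGroup) a N)).
  - exists N. intros n Hn. replace n with (N + (n - N))%nat by lia.
    eapply Rle_trans. apply Hk. specialize (Hinc (N + (n - N))%nat). lra.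
  - apply Clim_minus. exact Hs. apply Clim_const.
Qed.

(** An [eps / 3] argument: [N] is chosen from [M], which controls both tails at once, and only a
    finite sum remains to converge. *)
Lemma Clim_Cseries_dominated {T : Type} {F : (T -> Prop) -> Prop} {FF : ProperFilter F}
  (a : T -> nat -> C) (l : nat -> C) (M : nat -> R) :
  ex_series M ->
  F (fun t => forall n, (Cmod (a t n) <= M n)%R) ->
  (forall n, Clim F (fun t => a t n) (l n)) ->
  Clim F (fun t => Cseries (a t)) (Cseries l).
Proof.
  intros HM Ha Hl.
  assert (HlM : forall n, (Cmod (l n) <= M n)%R).
  { intros n. apply (Clim_Cmod_le (fun t => a t n)); [|apply Hl].
    revert Ha. apply filter_imp. auto. }
  apply Clim_eps. apply FF. intros eps He.
  assert (Htail : exists N, (Series M - sum_n M N < eps / 3)%R).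
  { pose proof (Series_correct M HM) as H.
    apply (is_lim_seq_spec (sum_n M) (Series M)) in H.
    assert (He3 : (0 < eps / 3)%R) by lra.
    destruct (H (mkposreal _ He3)) as [N HN].
    exists N. specialize (HN N (Nat.le_refl N)). simpl in HN.
    apply Rabs_def2 in HN. lra. }
  destruct Htail as [N HN].
  assert (Hsum : Clim F (fun t => sum_n (G := C_AbelianGroup) (a t) N)
                        (sum_n (G := C_AbelianGroup) l N)).
  { clear HN. induction N as [|N IH].
    - rewrite sum_O. apply (Clim_ext_loc (fun t => a t 0%nat)); [|apply Hl].
      apply filter_forall. intros t. now rewrite sum_O.
    - rewrite Csum_n_S.
      apply (Clim_ext_loc (fun t => sum_n (G := C_AbelianGroup) (a t) N + a t (S N))).
      + apply filter_forall. intros t. now rewrite Csum_n_S.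
      + apply Clim_plus; auto. }
  rewrite (Clim_eps F) in Hsum.
  assert (He3 : (0 < eps / 3)%R) by lra.
  generalize (filter_and _ _ Ha (Hsum _ He3)). apply filter_imp.
  intros t [H1 H2].
  pose proof (Cseries_tail (a t) M N H1 HM) as T1.
  pose proof (Cseries_tail l M N HlM HM) as T2.
  set (sa := sum_n (G := C_AbelianGroup) (a t) N) in *.
  set (sl := sum_n (G := C_AbelianGroup) l N) in *.
  replace (Cseries (a t) - Cseries l)
    with ((Cseries (a t) - sa) + ((sa - sl) + - (Cseries l - sl))) by ring.
  eapply Rle_lt_trans. apply Cmod_triangle.
  eapply Rle_lt_trans. apply Rplus_le_compat_l. apply Cmod_triangle.
  rewrite Cmod_opp. lra.
Qed.

(** * Calculus of complex derivatives *)

Lemma Clim_nbhd_id (z : C) : Clim (nbhd z) (fun w => w) z.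
Proof.
  apply Clim_eps. apply nbhd_filter. intros eps He.
  apply nbhd_intro with eps; auto.
Qed.

(** [nbhd z] is not punctured, so [g] may take the value [z]. *)
Lemma Clim_comp {T : Type} {F : (T -> Prop) -> Prop} {FF : Filter F}
  (g : T -> C) (f : C -> C) (z l : C) :
  Clim F g z -> Clim (nbhd z) f l -> Clim F (fun t => f (g t)) l.
Proof.
  rewrite (Clim_eps F g), (Clim_eps F). intros Hg Hf eps He.
  rewrite Clim_eps in Hf by apply nbhd_filter.
  destruct (nbhd_elim _ _ (Hf eps He)) as [d [Hd H]].
  generalize (Hg d Hd). apply filter_imp. intros t Ht. apply H, Ht.
Qed.

(* Caratheodory's form of differentiability, which makes the product and chain
   rules algebraic. *)
Definition cdiff (f : C -> C) (z l : C) : Prop :=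
  exists g : C -> C,
    nbhd z (fun w => f w = f z + (w - z) * g w) /\ Clim (nbhd z) g l.

Lemma cdiff_is_derive (f : C -> C) (z l : C) :
  cdiff f z l -> is_derive (K := C_AbsRing) (V := C_NormedModule) f z l.
Proof.
  intros [g [Hg Hl]]. split.
  - apply (@is_linear_scal_l C_AbsRing C_NormedModule l).
  - intros y Hy.
    (* [is_derive] quantifies over all limit points [y] of the neighbourhood filter of [z];
       separation leaves only [z]. *)
    assert (E : z = y).
    { apply (@is_filter_lim_locally_unique C_AbsRing (AbsRing_NormedModule C_AbsRing)). exact Hy. }
    subst y. intros eps.
    rewrite Clim_eps in Hl by apply nbhd_filter.
    generalize (filter_and _ _ Hg (Hl eps (cond_pos eps))).
    apply filter_imp. intros w [H1 H2].
    change (Cmod ((f w - f z) - (w - z) * l) <= eps * Cmod (w - z))%R.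
    rewrite H1.
    replace (f z + (w - z) * g w - f z - (w - z) * l)
      with ((g w - l) * (w - z)) by ring.
    rewrite Cmod_mult. apply Rmult_le_compat_r. apply Cmod_ge_0. lra.
Qed.

Lemma cdiff_ext_loc (f g : C -> C) (z l : C) :
  nbhd z (fun w => f w = g w) -> cdiff f z l -> cdiff g z l.
Proof.
  intros E [h [H1 H2]]. exists h. split; auto.
  assert (Ez : f z = g z).
  { destruct (nbhd_elim _ _ E) as [d [Hd H]]. apply H.
    replace (z - z) with (RtoC 0) by ring. now rewrite Cmod_0. }
  generalize (filter_and _ _ E H1). apply filter_imp.
  intros w [A B]. now rewrite <- A, <- Ez.
Qed.

Lemma cdiff_eq (f : C -> C) (z l m : C) : l = m -> cdiff f z l -> cdiff f z m.
Proof. now intros ->. Qed.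

Lemma cdiff_cont (f : C -> C) (z l : C) : cdiff f z l -> Clim (nbhd z) f (f z).
Proof.
  intros [g [H1 H2]].
  apply (Clim_ext_loc (fun w => f z + (w - z) * g w)).
  - revert H1. apply filter_imp. auto.
  - apply (Clim_eq _ (f z + (z - z) * l)). ring.
    apply Clim_plus. apply Clim_const. apply Clim_mult; auto.
    apply Clim_minus. apply Clim_nbhd_id. apply Clim_const.
Qed.

Lemma cdiff_const (c z : C) : cdiff (fun _ => c) z 0.
Proof.
  exists (fun _ => RtoC 0). split. apply filter_forall. intros. ring. apply Clim_const.
Qed.

Lemma cdiff_affine (a b z : C) : cdiff (fun w => a * w + b) z a.
Proof.
  exists (fun _ => a). split. apply filter_forall. intros. ring. apply Clim_const.
Qed.

Lemma cdiff_plus (f g : C -> C) (z l m : C) :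
  cdiff f z l -> cdiff g z m -> cdiff (fun w => f w + g w) z (l + m).
Proof.
  intros [F [H1 H2]] [G [H3 H4]]. exists (fun w => F w + G w). split.
  - generalize (filter_and _ _ H1 H3). apply filter_imp.
    intros w [-> ->]. ring.
  - apply Clim_plus; auto.
Qed.

Lemma cdiff_mult (f g : C -> C) (z l m : C) :
  cdiff f z l -> cdiff g z m -> cdiff (fun w => f w * g w) z (l * g z + f z * m).
Proof.
  intros [F [H1 H2]] Hg. pose proof (cdiff_cont _ _ _ Hg) as Hc.
  destruct Hg as [G [H3 H4]]. exists (fun w => F w * g w + f z * G w). split.
  - generalize (filter_and _ _ H1 H3). apply filter_imp.
    intros w [A B]. rewrite A, B at 1. rewrite B. ring.
  - apply Clim_plus; apply Clim_mult; auto. apply Clim_const.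
Qed.

(** Where [g] vanishes, the product rule only asks for continuity of [f]. This avoids
    differentiating [M] in its parameters at [- mu]. *)
Lemma cdiff_mult_zero (f g : C -> C) (z m : C) :
  Clim (nbhd z) f (f z) -> g z = 0 -> cdiff g z m ->
  cdiff (fun w => f w * g w) z (f z * m).
Proof.
  intros Hf Hz [G [H1 H2]]. exists (fun w => f w * G w). split.
  - revert H1. apply filter_imp. intros w A. rewrite A, Hz. ring.
  - apply Clim_mult; auto.
Qed.

Lemma cdiff_inv (f : C -> C) (z l : C) :
  f z <> 0 -> cdiff f z l -> cdiff (fun w => / f w) z (- l / (f z * f z)).
Proof.
  intros Hz Hf. pose proof (cdiff_cont _ _ _ Hf) as Hc.
  destruct Hf as [F [H1 H2]].
  exists (fun w => - F w * / (f w * f z)). split.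
  - generalize (filter_and _ _ H1 (Clim_neq_0 f _ Hz Hc)). apply filter_imp.
    intros w [A B].
    replace ((w - z) * (- F w * / (f w * f z)))
      with (- ((w - z) * F w) * / (f w * f z)) by ring.
    replace ((w - z) * F w) with (f w - f z) by (rewrite A; ring).
    field. auto.
  - apply Clim_mult. apply Clim_opp; auto. apply Clim_inv.
    apply Cmult_neq_0; auto. apply Clim_mult; auto. apply Clim_const.
Qed.

Lemma cdiff_comp (f g : C -> C) (z l m : C) :
  cdiff g z m -> cdiff f (g z) l -> cdiff (fun w => f (g w)) z (m * l).
Proof.
  intros Hg [F [H1 H2]]. pose proof (cdiff_cont _ _ _ Hg) as Hc.
  destruct Hg as [G [H3 H4]].
  exists (fun w => G w * F (g w)). split.
  - assert (H5 : nbhd z (fun w => f (g w) = f (g z) + (g w - g z) * F (g w))).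
    { destruct (nbhd_elim _ _ H1) as [d [Hd H]].
      rewrite Clim_eps in Hc by apply nbhd_filter.
      generalize (Hc d Hd). apply filter_imp. intros w Hw. apply H, Hw. }
    generalize (filter_and _ _ H3 H5). apply filter_imp.
    intros w [A B]. rewrite B, A at 1.
    replace (g w - g z) with ((w - z) * G w) by (rewrite A; ring). ring.
  - apply Clim_mult; auto. apply (Clim_comp g F (g z)); auto.
Qed.

(* Makes the local factorization of [cdiff] global. *)
Definition slope (f : C -> C) (z l w : C) : C :=
  if excluded_middle_informative (w = z) then l else (f w - f z) / (w - z).

Lemma slope_spec (f : C -> C) (z l w : C) : f w = f z + (w - z) * slope f z l w.
Proof.
  unfold slope. destruct excluded_middle_informative as [-> | H].
  - ring.
  - field. intros E. apply H. replace w with (w - z + z) by ring. rewrite E. ring.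
Qed.

Lemma cdiff_slope (f : C -> C) (z l : C) :
  cdiff f z l -> Clim (nbhd z) (slope f z l) l.
Proof.
  intros [g [H1 H2]]. rewrite Clim_eps in H2 |- * by apply nbhd_filter.
  intros eps He. generalize (filter_and _ _ H1 (H2 eps He)). apply filter_imp.
  intros w [A B]. unfold slope. destruct excluded_middle_informative as [E|E].
  - replace (l - l) with (RtoC 0) by ring. now rewrite Cmod_0.
  - rewrite A. replace ((f z + (w - z) * g w - f z) / (w - z)) with (g w); auto.
    field. intros E'. apply E. replace w with (w - z + z) by ring. rewrite E'. ring.
Qed.

Lemma cdiff_of_quadratic (f : C -> C) (z l : C) (K : R) :
  nbhd z (fun w => (Cmod (f w - f z - (w - z) * l) <= K * (Cmod (w - z) * Cmod (w - z)))%R) ->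
  cdiff f z l.
Proof.
  intros H. exists (slope f z l). split.
  - apply filter_forall. intros w. apply slope_spec.
  - apply Clim_eps. apply nbhd_filter. intros eps He.
    destruct (nbhd_elim _ _ H) as [d [Hd Hb]].
    pose proof (Rabs_pos K) as HK. pose proof (Rle_abs K) as HK'.
    (* [Rabs K + 1] is a positive denominator whatever the sign of [K]. *)
    apply nbhd_intro with (Rmin d (eps / (Rabs K + 1))).
    { apply Rmin_pos; auto. apply Rdiv_lt_0_compat; lra. }
    intros w Hw.
    assert (Hw1 : (Cmod (w - z) < d)%R) by (eapply Rlt_le_trans; [exact Hw | apply Rmin_l]).
    assert (Hw2 : (Cmod (w - z) * (Rabs K + 1) < eps)%R).
    { replace eps with (eps / (Rabs K + 1) * (Rabs K + 1))%R by (field; lra).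
      apply Rmult_lt_compat_r. lra. eapply Rlt_le_trans; [exact Hw | apply Rmin_r]. }
    specialize (Hb w Hw1).
    unfold slope. destruct excluded_middle_informative as [E|E].
    + replace (l - l) with (RtoC 0) by ring. now rewrite Cmod_0.
    + assert (Hnz : w - z <> 0).
      { intros E'. apply E. replace w with (w - z + z) by ring. rewrite E'. ring. }
      replace ((f w - f z) / (w - z) - l)
        with ((f w - f z - (w - z) * l) / (w - z)) by (field; auto).
      rewrite Cmod_div by auto.
      assert (Hp : (0 < Cmod (w - z))%R) by (apply Cmod_gt_0, Hnz).
      apply Rmult_lt_reg_r with (Cmod (w - z)); auto.
      unfold Rdiv. rewrite Rmult_assoc, Rinv_l, Rmult_1_r by lra.
      eapply Rle_lt_trans. exact Hb. nra.
Qed.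

(** Covers the point [w = z] of [slope], whose value there is the derivative. *)
Lemma cdiff_Cmod_le (f : C -> C) (z l : C) (K d : R) :
  (0 < d)%R -> cdiff f z l ->
  (forall w, (Cmod (w - z) < d)%R -> (Cmod (f w - f z) <= K * Cmod (w - z))%R) ->
  (Cmod l <= K)%R.
Proof.
  intros Hd [g [H1 H2]] HK. apply Rnot_lt_le. intros Hlt.
  rewrite Clim_eps in H2 by apply nbhd_filter.
  assert (He : (0 < Cmod l - K)%R) by lra.
  destruct (nbhd_elim _ _ (filter_and _ _ H1 (H2 _ He))) as [d' [Hd' H]].
  (* A test point at real distance [t] from [z] lies in both discs. *)
  pose (t := (Rmin d d' / 2)%R).
  assert (Ht : (0 < t)%R) by (unfold t; pose proof (Rmin_pos d d' Hd Hd'); lra).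
  pose proof (Rmin_l d d'). pose proof (Rmin_r d d').
  assert (E : z + RtoC t - z = RtoC t) by ring.
  assert (Et : Cmod (z + RtoC t - z) = t) by (rewrite E, Cmod_R, Rabs_pos_eq; lra).
  destruct (H (z + RtoC t)) as [A B]. { rewrite Et. unfold t in *; lra. }
  specialize (HK (z + RtoC t)).
  rewrite Et, A in HK.
  replace (f z + (z + RtoC t - z) * g (z + RtoC t) - f z)
    with ((z + RtoC t - z) * g (z + RtoC t)) in HK by ring.
  rewrite Cmod_mult, Et in HK.
  assert (Hg : (Cmod (g (z + RtoC t)%C) <= K)%R).
  { apply Rmult_le_reg_l with t; auto. rewrite (Rmult_comm t K). apply HK.
    unfold t in *; lra. }
  assert (Cmod l <= Cmod (g (z + RtoC t)%C) + Cmod (g (z + RtoC t)%C - l))%R.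
  { rewrite <- (Cmod_opp (g (z + RtoC t)%C - l)).
    replace l with (g (z + RtoC t) + - (g (z + RtoC t)%C - l)) at 1 by ring.
    apply Cmod_triangle. }
  lra.
Qed.

Lemma slope_Cmod_le (f : C -> C) (z l : C) (K d : R) (w : C) :
  cdiff f z l ->
  (forall w, (Cmod (w - z) < d)%R -> (Cmod (f w - f z) <= K * Cmod (w - z))%R) ->
  (Cmod (w - z) < d)%R -> (Cmod (slope f z l w) <= K)%R.
Proof.
  intros Hf HK Hw. unfold slope. destruct excluded_middle_informative as [E|E].
  - apply (cdiff_Cmod_le f z l K d); auto.
    eapply Rle_lt_trans; [apply Cmod_ge_0 | exact Hw].
  - assert (Hnz : w - z <> 0).
    { intros E'. apply E. replace w with (w - z + z) by ring. rewrite E'. ring. }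
    rewrite Cmod_div by auto.
    assert (Hp : (0 < Cmod (w - z))%R) by (apply Cmod_gt_0, Hnz).
    apply Rmult_le_reg_r with (Cmod (w - z)); auto.
    unfold Rdiv. rewrite Rmult_assoc, Rinv_l, Rmult_1_r by lra. auto.
Qed.

(** Termwise differentiation: the Caratheodory quotient of the sum is the sum of the [slope] terms,
    which the Lipschitz constants [M n] dominate near [z]. Convergence is assumed at [z] only; at
    nearby [w] it follows by adding [w - z] times the convergent series of slopes. *)
Lemma cdiff_Cseries (f : nat -> C -> C) (l : nat -> C) (z s : C) (M : nat -> R) (d : R) :
  (0 < d)%R -> ex_series M ->
  is_series (V := C_NormedModule) (fun n => f n z) s ->
  (forall n w, (Cmod (w - z) < d)%R ->
     (Cmod (f n w - f n z) <= M n * Cmod (w - z))%R) ->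
  (forall n, cdiff (f n) z (l n)) ->
  cdiff (fun w => Cseries (fun n => f n w)) z (Cseries l).
Proof.
  intros Hd HM Hs Hlip Hdiff.
  exists (fun w => Cseries (fun n => slope (f n) z (l n) w)). split.
  - apply nbhd_intro with d; auto. intros w Hw.
    rewrite (Cseries_unique _ _ Hs). apply Cseries_unique.
    assert (H : is_series (V := C_NormedModule) (fun n => slope (f n) z (l n) w)
                  (Cseries (fun n => slope (f n) z (l n) w))).
    { apply Cseries_correct with M; auto. intros n. apply slope_Cmod_le with d; auto. }
    apply (is_series_scal (K := C_AbsRing) (V := C_NormedModule) (w - z)) in H.
    pose proof (is_series_plus (V := C_NormedModule) _ _ _ _ Hs H) as H'.
    revert H'. apply is_series_ext. intros n. symmetry. apply slope_spec.
  - apply (Clim_Cseries_dominated (fun w n => slope (f n) z (l n) w) l M); auto.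
    + apply nbhd_intro with d; auto. intros w Hw n. apply slope_Cmod_le with d; auto.
    + intros n. apply cdiff_slope, Hdiff.
Qed.

(** * Exponentials and powers *)

(** Letting [K] depend on [b] allows each Taylor bound below to feed the next: a bound on the
    derivative becomes one of higher order on the function. *)
Lemma Rabs_le_mean_value (f df : R -> R) (b K : R) :
  f 0%R = 0%R -> (forall x, is_derive f x (df x)) ->
  (forall c, (Rabs c <= Rabs b)%R -> (Rabs (df c) <= K)%R) ->
  (Rabs (f b) <= K * Rabs b)%R.
Proof.
  intros H0 Hd HK.
  destruct (MVT_gen f 0 b df) as [c [Hc E]].
  - intros x _. apply Hd.
  - intros x _. apply continuity_pt_filterlim.
    apply (@ex_derive_continuous R_AbsRing R_NormedModule). eexists. apply Hd.
  - rewrite H0, !Rminus_0_r in E. rewrite E, Rabs_mult.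
    apply Rmult_le_compat_r. apply Rabs_pos. apply HK.
    revert Hc. unfold Rmin, Rmax. destruct Rle_dec; intros Hc;
      unfold Rabs; repeat destruct Rcase_abs; lra.
Qed.

Lemma Rabs_sin_le (b : R) : (Rabs (sin b) <= Rabs b)%R.
Proof.
  rewrite <- (Rmult_1_l (Rabs b)).
  apply (Rabs_le_mean_value sin cos). apply sin_0.
  - intros x. auto_derive; auto. ring.
  - intros c _. apply Rabs_le. apply COS_bound.
Qed.

Lemma Rabs_cos_sub_1_le (b : R) : (Rabs (cos b - 1) <= Rabs b * Rabs b)%R.
Proof.
  apply (Rabs_le_mean_value (fun x => cos x - 1)%R (fun x => - sin x)%R).
  - rewrite cos_0. ring.
  - intros x. auto_derive; auto. ring.
  - intros c Hc. rewrite Rabs_Ropp. eapply Rle_trans. apply Rabs_sin_le. exact Hc.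
Qed.

Lemma Rabs_sin_sub_le (b : R) : (Rabs (sin b - b) <= Rabs b * Rabs b)%R.
Proof.
  apply (Rabs_le_mean_value (fun x => sin x - x)%R (fun x => cos x - 1)%R).
  - rewrite sin_0. ring.
  - intros x. auto_derive; auto. ring.
  - intros c Hc. eapply Rle_trans; [|exact Hc].
    rewrite <- (Rmult_1_l (Rabs c)).
    apply (Rabs_le_mean_value (fun x => cos x - 1)%R (fun x => - sin x)%R).
    + rewrite cos_0. ring.
    + intros x. auto_derive; auto. ring.
    + intros d _. rewrite Rabs_Ropp. apply Rabs_le. apply SIN_bound.
Qed.

Lemma Rabs_exp_sub_1_le (a : R) : (Rabs (exp a - 1) <= exp (Rabs a) * Rabs a)%R.
Proof.
  apply (Rabs_le_mean_value (fun x => exp x - 1)%R exp).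
  - rewrite exp_0. ring.
  - intros x. auto_derive; auto. ring.
  - intros c Hc. rewrite Rabs_pos_eq by (left; apply exp_pos).
    destruct (Rle_lt_or_eq_dec c (Rabs a)) as [H|H].
    + eapply Rle_trans. apply Rle_abs. exact Hc.
    + left. now apply exp_increasing.
    + rewrite H. apply Rle_refl.
Qed.

Lemma exp_le_compat (a b : R) : (a <= b)%R -> (exp a <= exp b)%R.
Proof.
  intros [H|H]. left. now apply exp_increasing. rewrite H. apply Rle_refl.
Qed.

Lemma Rabs_exp_sub_1_sub_le (a : R) :
  (Rabs (exp a - 1 - a) <= exp (Rabs a) * Rabs a * Rabs a)%R.
Proof.
  apply (Rabs_le_mean_value (fun x => exp x - 1 - x)%R (fun x => exp x - 1)%R).
  - rewrite exp_0. ring.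
  - intros x. auto_derive; auto. ring.
  - intros c Hc. eapply Rle_trans. apply Rabs_exp_sub_1_le.
    apply Rmult_le_compat; auto using Rabs_pos. left; apply exp_pos.
    now apply exp_le_compat.
Qed.

Lemma Cmod_le_Rabs (x y : R) : (Cmod (x, y) <= Rabs x + Rabs y)%R.
Proof.
  replace ((x, y) : C) with (RtoC x + Ci * RtoC y)
    by (apply injective_projections; simpl; ring).
  eapply Rle_trans. apply Cmod_triangle.
  rewrite Cmod_mult, Cmod_Ci, !Cmod_R. lra.
Qed.

Lemma Im_le_Cmod (z : C) : (Rabs (Im z) <= Cmod z)%R.
Proof. eapply Rle_trans; [apply Rmax_r | apply (Rmax_Cmod z)]. Qed.

Lemma Cexp_0 : Cexp 0 = 1.
Proof.
  unfold Cexp. simpl. rewrite exp_0, cos_0, sin_0.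
  apply injective_projections; simpl; ring.
Qed.

Lemma Cexp_plus (z w : C) : Cexp (z + w) = Cexp z * Cexp w.
Proof.
  unfold Cexp. destruct z as [a b], w as [c d]. simpl.
  rewrite exp_plus, cos_plus, sin_plus.
  apply injective_projections; simpl; ring.
Qed.

Lemma Cexp_neq_0 (z : C) : Cexp z <> 0.
Proof.
  intros E. assert (H : Cexp z * Cexp (- z) = 1).
  { rewrite <- Cexp_plus. replace (z + - z) with (RtoC 0) by ring. apply Cexp_0. }
  rewrite E, Cmult_0_l in H. injection H. lra.
Qed.

Lemma Cexp_opp (z : C) : Cexp (- z) = / Cexp z.
Proof.
  pose proof (Cexp_neq_0 z) as Hz.
  assert (H : Cexp z * Cexp (- z) = 1).
  { rewrite <- Cexp_plus. replace (z + - z) with (RtoC 0) by ring. apply Cexp_0. }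
  replace (Cexp (- z)) with (/ Cexp z * (Cexp z * Cexp (- z))) by (field; auto).
  rewrite H. ring.
Qed.

Lemma Cexp_RtoC (a : R) : Cexp (RtoC a) = RtoC (exp a).
Proof.
  unfold Cexp. simpl. rewrite cos_0, sin_0.
  apply injective_projections; simpl; ring.
Qed.

Lemma Cexp_mult_INR (n : nat) (z : C) : Cexp (RtoC (INR n) * z) = Cpow (Cexp z) n.
Proof.
  induction n as [|n IH].
  - simpl. rewrite Cmult_0_l. apply Cexp_0.
  - rewrite S_INR, RtoC_plus, Cpow_S, <- IH, <- Cexp_plus. f_equal. ring.
Qed.

Lemma Cmod_Cexp (z : C) : Cmod (Cexp z) = exp (Re z).
Proof.
  unfold Cexp. rewrite Cmod_mult, Cmod_R, Rabs_pos_eq by (left; apply exp_pos).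
  replace (Cmod (cos (Im z), sin (Im z))) with 1%R. ring.
  unfold Cmod. simpl. rewrite <- sqrt_1 at 1. f_equal.
  pose proof (sin2_cos2 (Im z)) as H. unfold Rsqr in H. lra.
Qed.

Lemma Cmod_Cexp_le (z : C) : (Cmod (Cexp z) <= exp (Cmod z))%R.
Proof.
  rewrite Cmod_Cexp. apply exp_le_compat.
  eapply Rle_trans. apply Rle_abs. apply re_le_Cmod.
Qed.

(** For [z = a + i b] the real part is [e^a (cos b - 1) + (e^a - 1 - a)] and the imaginary part
    [e^a (sin b - b) + b (e^a - 1)]. Each of the four summands is at most [exp (Cmod z)] times the
    square of [Cmod z]. *)
Lemma Cmod_Cexp_sub_1_sub_le (z : C) :
  (Cmod (Cexp z - 1 - z) <= 4 * exp (Cmod z) * (Cmod z * Cmod z))%R.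
Proof.
  pose proof (re_le_Cmod z) as Ha. pose proof (Im_le_Cmod z) as Hb.
  pose proof (Cmod_ge_0 z) as Hr.
  assert (HE : (exp (Re z) <= exp (Cmod z))%R).
  { apply exp_le_compat. eapply Rle_trans. apply Rle_abs. exact Ha. }
  pose proof (exp_le_compat _ _ Ha) as HE'.
  pose proof (exp_pos (Re z)) as Hp.
  unfold Cexp. destruct z as [a b]. simpl Re in *. simpl Im in *.
  set (r := Cmod (a, b)) in *. set (E := exp r) in *.
  replace (RtoC (exp a) * (cos b, sin b) - 1 - (a, b))
    with ((exp a * (cos b - 1) + (exp a - 1 - a))%R,
          (exp a * (sin b - b) + b * (exp a - 1))%R)
    by (apply injective_projections; simpl; ring).
  eapply Rle_trans. apply Cmod_le_Rabs.
  pose proof (Rabs_pos a). pose proof (Rabs_pos b).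
  assert (Hrr : (Rabs b * Rabs b <= r * r)%R) by (apply Rmult_le_compat; auto).
  assert (H1 : (Rabs (exp a * (cos b - 1)) <= E * (r * r))%R).
  { rewrite Rabs_mult, (Rabs_pos_eq (exp a)) by lra.
    apply Rmult_le_compat; auto using Rabs_pos. lra.
    eapply Rle_trans. apply Rabs_cos_sub_1_le. auto. }
  assert (H2 : (Rabs (exp a * (sin b - b)) <= E * (r * r))%R).
  { rewrite Rabs_mult, (Rabs_pos_eq (exp a)) by lra.
    apply Rmult_le_compat; auto using Rabs_pos. lra.
    eapply Rle_trans. apply Rabs_sin_sub_le. auto. }
  assert (H3 : (Rabs (exp a - 1 - a) <= E * (r * r))%R).
  { eapply Rle_trans. apply Rabs_exp_sub_1_sub_le. rewrite Rmult_assoc.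
    apply Rmult_le_compat; auto. left; apply exp_pos.
    apply Rmult_le_pos; auto. apply Rmult_le_compat; auto. }
  assert (H4 : (Rabs (b * (exp a - 1)) <= E * (r * r))%R).
  { rewrite Rabs_mult.
    replace (E * (r * r))%R with (r * (E * r))%R by ring.
    apply Rmult_le_compat; auto using Rabs_pos.
    eapply Rle_trans. apply Rabs_exp_sub_1_le.
    apply Rmult_le_compat; auto. left; apply exp_pos. }
  pose proof (Rabs_triang (exp a * (cos b - 1)) (exp a - 1 - a)).
  pose proof (Rabs_triang (exp a * (sin b - b)) (b * (exp a - 1))).
  lra.
Qed.

Lemma cdiff_Cexp (z : C) : cdiff Cexp z (Cexp z).
Proof.
  (* The addition law moves the estimate to the origin; [exp 1] comes from restricting to
     [Cmod (w - z) < 1]. *)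
  apply cdiff_of_quadratic with (Cmod (Cexp z) * (4 * exp 1))%R.
  apply nbhd_intro with 1%R. lra. intros w Hw.
  replace (Cexp w) with (Cexp z * Cexp (w - z)).
  2: rewrite <- Cexp_plus; f_equal; ring.
  replace (Cexp z * Cexp (w - z) - Cexp z - (w - z) * Cexp z)
    with (Cexp z * (Cexp (w - z) - 1 - (w - z))) by ring.
  rewrite Cmod_mult, !Rmult_assoc.
  apply Rmult_le_compat_l. apply Cmod_ge_0.
  eapply Rle_trans. apply Cmod_Cexp_sub_1_sub_le. rewrite Rmult_assoc.
  apply Rmult_le_compat_l. lra. apply Rmult_le_compat_r.
  apply Rmult_le_pos; apply Cmod_ge_0. apply exp_le_compat. lra.
Qed.

Lemma Cpower_plus (z v w : C) : Cpower z (v + w) = Cpower z v * Cpower z w.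
Proof. unfold Cpower. rewrite <- Cexp_plus. f_equal. ring. Qed.

Lemma Cpower_opp (z w : C) : Cpower z (- w) = / Cpower z w.
Proof. unfold Cpower. rewrite <- Cexp_opp. f_equal. ring. Qed.

Lemma Cpower_neq_0 (z w : C) : Cpower z w <> 0.
Proof. apply Cexp_neq_0. Qed.

Lemma Clog_pos (x : R) : (0 < x)%R -> Clog (RtoC x) = RtoC (ln x).
Proof.
  intros Hx. unfold Clog, Carg. simpl.
  rewrite Cmod_R, Rabs_pos_eq by lra.
  destruct Rle_dec as [_|H]; [|lra].
  replace (x / x)%R with 1%R by (field; lra). now rewrite acos_1.
Qed.

Lemma Clog_neg (x : R) : (0 < x)%R -> Clog (RtoC (- x)) = (ln x, PI).
Proof.
  intros Hx. unfold Clog, Carg. simpl.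
  rewrite Cmod_R, Rabs_Ropp, Rabs_pos_eq by lra.
  destruct Rle_dec as [_|H]; [|lra].
  replace (- x / x)%R with (- (1))%R by (field; lra).
  now rewrite acos_opp, acos_1, Rminus_0_r.
Qed.

Lemma Cpower_pos (x : R) (w : C) :
  (0 < x)%R -> Cpower (RtoC x) w = Cexp (w * RtoC (ln x)).
Proof. intros Hx. unfold Cpower. now rewrite Clog_pos. Qed.

Lemma Cpower_neg_INR (x : R) (n : nat) :
  (0 < x)%R -> Cpower (RtoC (- x)) (RtoC (INR n)) = Cpow (RtoC (- x)) n.
Proof.
  intros Hx. unfold Cpower. rewrite Cexp_mult_INR. f_equal.
  rewrite Clog_neg by auto. unfold Cexp. simpl.
  rewrite exp_ln, cos_PI, sin_PI by auto.
  apply injective_projections; simpl; ring.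
Qed.

Lemma cdiff_Cpower (x : R) (z : C) :
  (0 < x)%R -> cdiff (Cpower (RtoC x)) z (RtoC (ln x) * Cpower (RtoC x) z).
Proof.
  intros Hx. apply (cdiff_ext_loc (fun w => Cexp (RtoC (ln x) * w + 0))).
  - apply filter_forall. intros w. rewrite Cpower_pos by auto. f_equal. ring.
  - rewrite Cpower_pos by auto. replace (z * RtoC (ln x)) with (RtoC (ln x) * z + 0) by ring.
    apply (cdiff_comp Cexp (fun w => RtoC (ln x) * w + 0)).
    apply cdiff_affine. apply cdiff_Cexp.
Qed.

(** * The reciprocal Gamma function *)

(* The factorization below starts at [n = 1], since [Cpower 0 z] is a junk value. *)
Definition euler_prod (n : nat) (z : C) : C :=
  poch z (S n) / (RtoC (INR (fact n)) * Cpower (RtoC (INR n)) z).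

Definition euler_log (m : nat) : R := ln ((INR m + 2) / (INR m + 1)).

(** The relative change of Euler's approximant from [n = m + 1] to [n = m + 2]. *)
Definition euler_factor (m : nat) (z : C) : C :=
  (1 + z / RtoC (INR m + 2)) * Cexp (- (z * RtoC (euler_log m))) - 1.

(* Summable by telescoping; dominates the Lipschitz constants of [euler_factor m] on discs. *)
Definition tel (m : nat) : R := (/ ((INR m + 1) * (INR m + 2)))%R.

Lemma RtoC_neq_0 (x : R) : x <> 0%R -> RtoC x <> 0.
Proof. intros H E. apply H. now injection E. Qed.

Lemma RtoC_fact_neq_0 (n : nat) : RtoC (INR (fact n)) <> 0.
Proof. apply RtoC_neq_0, INR_fact_neq_0. Qed.

Lemma euler_prod_rec (m : nat) (z : C) :
  euler_prod (S (S m)) z = euler_prod (S m) z * (1 + euler_factor m z).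
Proof.
  pose proof (pos_INR m) as Hm.
  unfold euler_prod, euler_factor, euler_log.
  rewrite !Cpower_pos by (apply lt_0_INR; lia).
  rewrite ln_div by lra.
  change (poch z (S (S (S m)))) with (poch z (S (S m)) * (z + RtoC (INR (S (S m))))).
  change (fact (S (S m))) with (S (S m) * fact (S m))%nat.
  rewrite mult_INR, (S_INR (S m)), (S_INR m).
  replace (INR m + 1 + 1)%R with (INR m + 2)%R by ring.
  replace (- (z * RtoC (ln (INR m + 2) - ln (INR m + 1))))
    with (z * RtoC (ln (INR m + 1)) + - (z * RtoC (ln (INR m + 2))))
    by (rewrite RtoC_minus; ring).
  rewrite Cexp_plus, Cexp_opp, RtoC_mult.
  field. repeat split; try apply Cexp_neq_0; try apply RtoC_fact_neq_0.
  apply RtoC_neq_0. lra.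
Qed.

Lemma euler_prod_1 (z : C) : euler_prod 1 z = z * (z + 1).
Proof.
  unfold euler_prod. simpl. rewrite Cpower_pos, ln_1, Cmult_0_r, Cexp_0 by lra.
  field.
Qed.

Lemma euler_log_bounds (m : nat) :
  (/ (INR m + 2) <= euler_log m <= / (INR m + 1))%R.
Proof.
  pose proof (pos_INR m) as Hm. unfold euler_log.
  (* Applied to [(m+2)/(m+1)] this gives the upper bound, applied to its inverse the lower one. *)
  assert (Hln : forall t, (0 < t -> ln t <= t - 1)%R).
  { intros t Ht. rewrite <- (ln_exp (t - 1)). apply Rcomplements.ln_le; auto.
    pose proof (exp_ineq1_le (t - 1)). lra. }
  split.
  - replace ((INR m + 2) / (INR m + 1))%R with (/ ((INR m + 1) / (INR m + 2)))%R
      by (field; lra).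
    rewrite ln_Rinv by (apply Rdiv_lt_0_compat; lra).
    assert (H : (0 < (INR m + 1) / (INR m + 2))%R) by (apply Rdiv_lt_0_compat; lra).
    apply Hln in H.
    replace ((INR m + 1) / (INR m + 2) - 1)%R with (- / (INR m + 2))%R in H by (field; lra).
    lra.
  - eapply Rle_trans. apply Hln. apply Rdiv_lt_0_compat; lra.
    right. field. lra.
Qed.

Lemma tel_pos (m : nat) : (0 < tel m)%R.
Proof. pose proof (pos_INR m). apply Rinv_0_lt_compat. nra. Qed.

Lemma tel_eq (m : nat) : tel m = (/ (INR m + 1) - / (INR (S m) + 1))%R.
Proof. pose proof (pos_INR m). unfold tel. rewrite S_INR. field. lra. Qed.

Lemma ex_series_tel (K : R) : ex_series (fun m => K * tel m)%R.
Proof.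
  apply (ex_series_scal K tel). exists 1%R.
  assert (H : forall n, (1 - / (INR (S n) + 1))%R = sum_n tel n).
  { induction n as [|n IH].
    - rewrite sum_O. unfold tel. simpl. field.
    - rewrite sum_n_RS, <- IH, tel_eq. ring. }
  change (is_lim_seq (sum_n tel) 1%R).
  apply (is_lim_seq_ext (fun n => 1 - / (INR (S n) + 1))%R).
  { exact H. }
  enough (H1 : is_lim_seq (fun n => 1 - / (INR (S n) + 1))%R (1 - 0)%R)
    by now rewrite Rminus_0_r in H1.
  apply is_lim_seq_minus'. apply is_lim_seq_const.
  apply (is_lim_seq_ext (fun n => / INR (n + 2))%R).
  { intros n. rewrite S_INR, plus_INR. simpl. f_equal. ring. }
  apply (is_lim_seq_incr_n (fun n => / INR n)%R 2).
  apply (is_lim_seq_inv INR p_infty); [apply is_lim_seq_INR | discriminate].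
Qed.

Lemma euler_log_le_1 (m : nat) : (0 <= euler_log m <= 1)%R.
Proof.
  pose proof (pos_INR m). destruct (euler_log_bounds m) as [H1 H2].
  assert (0 < / (INR m + 2))%R by (apply Rinv_0_lt_compat; lra).
  assert (/ (INR m + 1) <= 1)%R.
  { rewrite <- Rinv_1. apply Rinv_le_contravar; lra. }
  lra.
Qed.

(** [exp r] bounds the exponential pulled out of the difference, [1 + r] the linear factor, and
    [16 * exp (2 * r) * r] the second-order remainder of the exponential, where two points of the
    disc differ by at most [2 * r]. The last [1 + r] bounds the first-order part. *)
Definition lipK (r : R) : R := (exp r * ((1 + r) * (16 * exp (2 * r) * r) + 1 + r))%R.

Lemma euler_factor_lipschitz (r : R) (m : nat) (z w : C) :
  (Cmod z <= r)%R -> (Cmod w <= r)%R ->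
  (Cmod (euler_factor m z - euler_factor m w) <= lipK r * tel m * Cmod (z - w))%R.
Proof.
  intros Hz Hw.
  pose proof (pos_INR m) as Hm. pose proof (tel_pos m) as Htp.
  destruct (euler_log_bounds m) as [HL1 HL2].
  pose proof (euler_log_le_1 m) as [HL3 HL4].
  pose proof (Cmod_ge_0 z) as Hz0.
  set (L := euler_log m) in *. set (n := (INR m + 2)%R) in *.
  assert (Hn : (2 <= n)%R) by (unfold n; lra).
  assert (Hin : (0 < / n <= 1)%R).
  { split. apply Rinv_0_lt_compat; lra. rewrite <- Rinv_1. apply Rinv_le_contravar; lra. }
  assert (Htel : tel m = (/ (INR m + 1) * / n)%R).
  { unfold tel, n. apply Rinv_mult. }
  (* From [L <= 1/(m+1)] and [m + 2 <= 2 (m + 1)]. *)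
  assert (HLL : (L * L <= 2 * tel m)%R).
  { apply Rle_trans with (/ (INR m + 1) * / (INR m + 1))%R.
    - apply Rmult_le_compat; lra.
    - rewrite Htel. replace (2 * (/ (INR m + 1) * / n))%R with (/ (INR m + 1) * (2 * / n))%R by ring.
      apply Rmult_le_compat_l. left; apply Rinv_0_lt_compat; lra.
      replace (2 * / n)%R with (/ (n / 2))%R by (field; lra).
      apply Rinv_le_contravar; unfold n; lra. }
  assert (HLn : (L - / n <= tel m)%R).
  { rewrite tel_eq, S_INR. replace (INR m + 1 + 1)%R with n by (unfold n; ring). lra. }
  assert (HLn2 : (L * / n <= tel m)%R).
  { rewrite Htel. apply Rmult_le_compat_r; lra. }
  set (h := z - w).
  assert (Hh : (Cmod h <= 2 * r)%R).
  { unfold h, Cminus. eapply Rle_trans. apply Cmod_triangle. rewrite Cmod_opp. lra. }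
  pose proof (Cmod_ge_0 h) as Hh0.
  (* Subtracting the linear part of the exponential exposes the cancellation: the first-order terms
     [h / n] and [h * L] leave only [L - / n], which is already of size [tel m]. *)
  assert (E : euler_factor m z - euler_factor m w = Cexp (- (w * RtoC L)) *
     ((1 + z / RtoC n) * (Cexp (- (h * RtoC L)) - 1 - - (h * RtoC L))
      - h * (RtoC (L - / n) + RtoC (L * / n) * z))).
  { unfold euler_factor. fold L n.
    replace (- (z * RtoC L)) with (- (w * RtoC L) + - (h * RtoC L)) by (unfold h; ring).
    rewrite Cexp_plus, RtoC_minus, RtoC_mult, RtoC_inv by lra. unfold h. field.
    apply RtoC_neq_0; lra. }
  rewrite E, Cmod_mult.
  assert (B1 : (Cmod (Cexp (- (w * RtoC L))) <= exp r)%R).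
  { eapply Rle_trans. apply Cmod_Cexp_le. apply exp_le_compat.
    rewrite Cmod_opp, Cmod_mult, Cmod_R, Rabs_pos_eq by lra.
    pose proof (Cmod_ge_0 w). nra. }
  assert (B2 : (Cmod (1 + z / RtoC n) <= 1 + r)%R).
  { eapply Rle_trans. apply Cmod_triangle. rewrite Cmod_1.
    rewrite Cmod_div, Cmod_R, Rabs_pos_eq by (try apply RtoC_neq_0; lra).
    unfold Rdiv. nra. }
  assert (B3 : (Cmod (Cexp (- (h * RtoC L)) - 1 - - (h * RtoC L))
                <= (16 * exp (2 * r) * r) * (tel m * Cmod h))%R).
  { eapply Rle_trans. apply Cmod_Cexp_sub_1_sub_le.
    rewrite Cmod_opp, Cmod_mult, Cmod_R, (Rabs_pos_eq L) by lra.
    assert (X1 : (exp (Cmod h * L) <= exp (2 * r))%R) by (apply exp_le_compat; nra).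
    assert (X2 : (Cmod h * L * (Cmod h * L) <= (4 * r) * (tel m * Cmod h))%R).
    { replace (Cmod h * L * (Cmod h * L))%R with ((Cmod h * Cmod h) * (L * L))%R by ring.
      replace ((4 * r) * (tel m * Cmod h))%R with ((2 * r * Cmod h) * (2 * tel m))%R by ring.
      apply Rmult_le_compat; auto; nra. }
    replace (16 * exp (2 * r) * r * (tel m * Cmod h))%R
      with (4 * exp (2 * r) * ((4 * r) * (tel m * Cmod h)))%R by ring.
    pose proof (exp_pos (Cmod h * L)).
    apply Rmult_le_compat; try lra. apply Rle_0_sqr. }
  assert (B4 : (Cmod (RtoC (L - / n) + RtoC (L * / n) * z) <= (1 + r) * tel m)%R).
  { eapply Rle_trans. apply Cmod_triangle. rewrite Cmod_mult, !Cmod_R.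
    rewrite !Rabs_pos_eq by nra.
    assert (L * / n * Cmod z <= tel m * r)%R by (apply Rmult_le_compat; nra). lra. }
  unfold lipK. rewrite !Rmult_assoc.
  apply Rmult_le_compat; try apply Cmod_ge_0. exact B1.
  unfold Cminus. eapply Rle_trans. apply Cmod_triangle.
  rewrite Cmod_opp, !Cmod_mult.
  replace (((1 + r) * (16 * (exp (2 * r) * r)) + 1 + r) * (tel m * Cmod h))%R
    with ((1 + r) * ((16 * exp (2 * r) * r) * (tel m * Cmod h)) + Cmod h * ((1 + r) * tel m))%R by ring.
  apply Rplus_le_compat.
  - apply Rmult_le_compat; auto; apply Cmod_ge_0.
  - apply Rmult_le_compat_l; auto.
Qed.

(** The factor [1 + r] makes one constant serve both as Lipschitz constant and as size bound, since
    [euler_factor m] vanishes at 0. *)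
Definition ubound (r : R) : R := (lipK r * (1 + r))%R.

Lemma lipK_pos (r : R) : (0 <= r)%R -> (0 <= lipK r)%R.
Proof.
  intros Hr. unfold lipK. pose proof (exp_pos r). pose proof (exp_pos (2 * r)).
  assert (0 <= exp (2 * r) * r)%R by nra. 
  apply Rmult_le_pos. lra. nra.
Qed.

Lemma euler_factor_lipschitz' (r : R) (m : nat) (z w : C) :
  (Cmod z <= r)%R -> (Cmod w <= r)%R ->
  (Cmod (euler_factor m z - euler_factor m w) <= ubound r * tel m * Cmod (z - w))%R.
Proof.
  intros Hz Hw. eapply Rle_trans. apply (euler_factor_lipschitz r); auto.
  apply Rmult_le_compat_r. apply Cmod_ge_0.
  apply Rmult_le_compat_r. left; apply tel_pos.
  pose proof (Cmod_ge_0 z). pose proof (lipK_pos r). unfold ubound. nra.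
Qed.

Lemma euler_factor_Cmod_le (r : R) (m : nat) (z : C) :
  (Cmod z <= r)%R -> (Cmod (euler_factor m z) <= ubound r * tel m)%R.
Proof.
  intros Hz. pose proof (Cmod_ge_0 z) as H0.
  assert (E : euler_factor m 0 = 0).
  { unfold euler_factor. replace (- (0 * RtoC (euler_log m))) with (RtoC 0) by ring.
    rewrite Cexp_0. unfold Cdiv. ring. }
  replace (euler_factor m z) with (euler_factor m z - euler_factor m 0) by (rewrite E; ring).
  eapply Rle_trans. apply (euler_factor_lipschitz r); auto. rewrite Cmod_0; lra.
  replace (z - 0) with z by ring. unfold ubound.
  pose proof (lipK_pos r). pose proof (tel_pos m).
  replace (lipK r * (1 + r) * tel m)%R with (lipK r * tel m * (1 + r))%R by ring.
  apply Rmult_le_compat_l; try lra. apply Rmult_le_pos; lra.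
Qed.

(** [2 * (1 + r) * (1 + r)] dominates [z (z + 1)] on the disc and its Lipschitz constant. The
    exponential dominates the product of all [1 + 2 * (ubound r * tel m)], because the [tel m] sum
    to 1. *)
Definition Pbound (r : R) : R := (2 * (1 + r) * (1 + r) * exp (2 * ubound r))%R.

Lemma ubound_pos (r : R) : (0 <= r)%R -> (0 <= ubound r)%R.
Proof. intros H. pose proof (lipK_pos r H). unfold ubound. nra. Qed.

(* Bounding [euler_prod] and its Lipschitz constant by the same number makes that number
   submultiplicative: each step multiplies it by at most [1 + 2 * (ubound r * tel m)]. *)
Lemma euler_prod_bounds (r : R) (m : nat) (z w : C) :
  (Cmod z <= r)%R -> (Cmod w <= r)%R ->
  (Cmod (euler_prod (S m) z) <= Pbound r)%R /\
  (Cmod (euler_prod (S m) z - euler_prod (S m) w) <= Pbound r * Cmod (z - w))%R.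
Proof.
  intros Hz Hw.
  pose proof (Cmod_ge_0 z) as Hz0. pose proof (Cmod_ge_0 w) as Hw0.
  pose proof (Cmod_ge_0 (z - w)) as Hh0.
  assert (Hr : (0 <= r)%R) by lra.
  pose proof (ubound_pos r Hr) as HU.
  (* [1 - / (INR m + 1)] is the sum of [tel k] over [k < m], so [B] grows exactly as the induction
     needs and stays below [Pbound r]. *)
  pose (B := fun m => (2 * (1 + r) * (1 + r) * exp (2 * ubound r * (1 - / (INR m + 1))))%R).
  assert (HB0 : forall m, (0 <= B m)%R).
  { intros k. unfold B. pose proof (exp_pos (2 * ubound r * (1 - / (INR k + 1)))). nra. }
  assert (HBS : forall m, (B m * (1 + 2 * (ubound r * tel m)) <= B (S m))%R).
  { intros k. unfold B.
    replace (2 * ubound r * (1 - / (INR (S k) + 1)))%R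
      with (2 * ubound r * (1 - / (INR k + 1)) + 2 * (ubound r * tel k))%R
      by (rewrite tel_eq; ring).
    rewrite exp_plus, !Rmult_assoc.
    repeat (apply Rmult_le_compat_l; [lra|]).
    apply Rmult_le_compat_l. left; apply exp_pos. apply exp_ineq1_le. }
  assert (H : (Cmod (euler_prod (S m) z) <= B m)%R /\ (Cmod (euler_prod (S m) w) <= B m)%R /\
    (Cmod (euler_prod (S m) z - euler_prod (S m) w) <= B m * Cmod (z - w))%R).
  { induction m as [|m [IH1 [IH2 IH3]]].
    - rewrite !euler_prod_1. unfold B. simpl INR.
      replace (2 * ubound r * (1 - / (0 + 1)))%R with 0%R by field.
      rewrite exp_0, Rmult_1_r.
      assert (H : forall v, (Cmod v <= r -> Cmod (v * (v + 1)) <= 2 * (1 + r) * (1 + r))%R).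
      { intros v Hv. rewrite Cmod_mult. pose proof (Cmod_ge_0 v).
        pose proof (Cmod_triangle v 1) as Ht. rewrite Cmod_1 in Ht.
        pose proof (Cmod_ge_0 (v + 1)). nra. }
      repeat split; auto.
      replace (z * (z + 1) - w * (w + 1)) with ((z + w + 1) * (z - w)) by ring.
      rewrite Cmod_mult. apply Rmult_le_compat_r; auto.
      pose proof (Cmod_triangle (z + w) 1) as Ht. rewrite Cmod_1 in Ht.
      pose proof (Cmod_triangle z w). nra.
    - rewrite !euler_prod_rec. specialize (HBS m). specialize (HB0 m).
      pose proof (tel_pos m) as Ht.
      pose proof (euler_factor_Cmod_le r m z Hz) as U1.
      pose proof (euler_factor_Cmod_le r m w Hw) as U2.
      pose proof (euler_factor_lipschitz' r m z w Hz Hw) as U3.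
      assert (HUt : (0 <= ubound r * tel m)%R) by nra.
      set (c := (ubound r * tel m)%R) in *.
      assert (Hbd : forall v, (Cmod (euler_prod (S m) v) <= B m -> Cmod (euler_factor m v) <= c ->
                     Cmod (euler_prod (S m) v * (1 + euler_factor m v)) <= B (S m))%R).
      { intros v H1 H2. rewrite Cmod_mult. eapply Rle_trans; [|exact HBS].
        apply Rmult_le_compat; try apply Cmod_ge_0; auto.
        eapply Rle_trans. apply Cmod_triangle. rewrite Cmod_1. lra. }
      repeat split; auto.
      replace (euler_prod (S m) z * (1 + euler_factor m z) - euler_prod (S m) w * (1 + euler_factor m w))
        with ((euler_prod (S m) z - euler_prod (S m) w) * (1 + euler_factor m z)
              + euler_prod (S m) w * (euler_factor m z - euler_factor m w)) by ring.
      eapply Rle_trans. apply Cmod_triangle. rewrite !Cmod_mult.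
      apply Rle_trans with (B m * (1 + 2 * c) * Cmod (z - w))%R.
      2: apply Rmult_le_compat_r; auto.
      replace (B m * (1 + 2 * c) * Cmod (z - w))%R
        with ((B m * Cmod (z - w)) * (1 + c) + B m * (c * Cmod (z - w)))%R by ring.
      apply Rplus_le_compat; apply Rmult_le_compat; try apply Cmod_ge_0; auto.
      eapply Rle_trans. apply Cmod_triangle. rewrite Cmod_1. lra. }
  assert (HBm : (B m <= Pbound r)%R).
  { unfold B, Pbound. apply Rmult_le_compat_l. nra. apply exp_le_compat.
    pose proof (pos_INR m).
    assert (0 < / (INR m + 1))%R by (apply Rinv_0_lt_compat; lra). nra. }
  destruct H as [H1 [_ H3]]. split. lra.
  eapply Rle_trans. exact H3. apply Rmult_le_compat_r; auto.
Qed.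

(** By [euler_prod_rec] this is the difference of consecutive approximants: the infinite product
    becomes a series, to which [cdiff_Cseries] applies. *)
Definition euler_diff (m : nat) (z : C) : C := euler_prod (S m) z * euler_factor m z.

Lemma euler_diff_bounds (r : R) (m : nat) (z w : C) :
  (Cmod z <= r)%R -> (Cmod w <= r)%R ->
  (Cmod (euler_diff m z) <= 2 * Pbound r * ubound r * tel m)%R /\
  (Cmod (euler_diff m z - euler_diff m w) <= 2 * Pbound r * ubound r * tel m * Cmod (z - w))%R.
Proof.
  intros Hz Hw.
  destruct (euler_prod_bounds r m z w Hz Hw) as [P1 P3].
  destruct (euler_prod_bounds r m w z Hw Hz) as [P2 _].
  pose proof (euler_factor_Cmod_le r m z Hz) as U1.
  pose proof (euler_factor_lipschitz' r m z w Hz Hw) as U3.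
  pose proof (tel_pos m) as Ht.
  assert (Hr : (0 <= r)%R) by (pose proof (Cmod_ge_0 z); lra).
  pose proof (ubound_pos r Hr) as HU.
  assert (HP : (0 <= Pbound r)%R) by (pose proof (Cmod_ge_0 (euler_prod (S m) z)); lra).
  unfold euler_diff. split.
  - rewrite Cmod_mult. apply Rle_trans with (Pbound r * (ubound r * tel m))%R.
    apply Rmult_le_compat; auto; apply Cmod_ge_0.
    assert (0 <= Pbound r * (ubound r * tel m))%R by (apply Rmult_le_pos; nra). lra.
  - replace (euler_prod (S m) z * euler_factor m z - euler_prod (S m) w * euler_factor m w)
      with ((euler_prod (S m) z - euler_prod (S m) w) * euler_factor m z
            + euler_prod (S m) w * (euler_factor m z - euler_factor m w)) by ring.
    eapply Rle_trans. apply Cmod_triangle. rewrite !Cmod_mult.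
    replace (2 * Pbound r * ubound r * tel m * Cmod (z - w))%R
      with ((Pbound r * Cmod (z - w)) * (ubound r * tel m)
            + Pbound r * (ubound r * tel m * Cmod (z - w)))%R by ring.
    apply Rplus_le_compat; apply Rmult_le_compat; try apply Cmod_ge_0; auto.
Qed.

(** * Convergence of Euler's limit and holomorphy of its value *)

Lemma is_series_euler_diff (z : C) :
  is_series (V := C_NormedModule) (fun m => euler_diff m z) (Cseries (fun m => euler_diff m z)).
Proof.
  apply Cseries_correct with (fun m => 2 * Pbound (Cmod z) * ubound (Cmod z) * tel m)%R.
  - intros m. apply (euler_diff_bounds (Cmod z) m z z); lra.
  - apply ex_series_tel.
Qed.

Lemma euler_prod_Clim_series (z : C) :
  Clim eventually (fun n => euler_prod n z) (euler_prod 1 z + Cseries (fun m => euler_diff m z)).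
Proof.
  assert (H : forall n, euler_prod (S (S n)) z
              = euler_prod 1 z + sum_n (G := C_AbelianGroup) (fun m => euler_diff m z) n).
  { induction n as [|n IH].
    - rewrite sum_O, euler_prod_rec. unfold euler_diff. ring.
    - rewrite Csum_n_S, Cplus_assoc, <- IH, euler_prod_rec. unfold euler_diff. ring. }
  assert (HC : Clim eventually (fun n => euler_prod (S (S n)) z)
                 (euler_prod 1 z + Cseries (fun m => euler_diff m z))).
  { apply (Clim_ext_loc (fun n => euler_prod 1 z
             + sum_n (G := C_AbelianGroup) (fun m => euler_diff m z) n)).
    - apply filter_forall. intros n. now rewrite H.
    - apply Clim_plus. apply Clim_const. apply is_series_euler_diff. }
  apply Clim_eps. apply eventually_filter. intros eps He.
  rewrite Clim_eps in HC by apply eventually_filter.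
  destruct (HC eps He) as [N HN]. exists (S (S N)). intros n Hn.
  destruct n as [|[|n]]; try lia. apply HN. lia.
Qed.

Lemma rGamma_series (z : C) : rGamma z = euler_prod 1 z + Cseries (fun m => euler_diff m z).
Proof. apply Climseq_unique, euler_prod_Clim_series. Qed.

Lemma euler_prod_Clim (z : C) : Clim eventually (fun n => euler_prod n z) (rGamma z).
Proof. rewrite rGamma_series. apply euler_prod_Clim_series. Qed.

Definition ex_cdiff (f : C -> C) (z : C) : Prop := exists l, cdiff f z l.

Lemma ex_cdiff_euler_factor (m : nat) (z : C) : ex_cdiff (euler_factor m) z.
Proof.
  eexists.
  apply (cdiff_ext_loc (fun w => (/ RtoC (INR m + 2) * w + 1)
                          * Cexp (- RtoC (euler_log m) * w + 0) + - (1))).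
  - apply filter_forall. intros w. unfold euler_factor, Cminus, Cdiv.
    f_equal. f_equal. ring. f_equal. ring.
  - apply cdiff_plus; [|apply cdiff_const]. apply cdiff_mult. apply cdiff_affine.
    apply (cdiff_comp Cexp (fun w => - RtoC (euler_log m) * w + 0)).
    apply cdiff_affine. apply cdiff_Cexp.
Qed.

Lemma ex_cdiff_euler_prod (m : nat) (z : C) : ex_cdiff (euler_prod (S m)) z.
Proof.
  induction m as [|m [l IH]].
  - eexists. apply (cdiff_ext_loc (fun w => (1 * w + 0) * (1 * w + 1))).
    + apply filter_forall. intros w. rewrite euler_prod_1. ring.
    + apply cdiff_mult; apply cdiff_affine.
  - destruct (ex_cdiff_euler_factor m z) as [k Hk]. eexists.
    apply (cdiff_ext_loc (fun w => euler_prod (S m) w * (1 + euler_factor m w))).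
    + apply filter_forall. intros w. now rewrite euler_prod_rec.
    + apply cdiff_mult. exact IH. apply cdiff_plus. apply cdiff_const. exact Hk.
Qed.

Lemma ex_cdiff_rGamma (z : C) : ex_cdiff rGamma z.
Proof.
  destruct (ex_cdiff_euler_prod 0 z) as [l0 H0].
  assert (HD : forall m, ex_cdiff (euler_diff m) z).
  { intros m. destruct (ex_cdiff_euler_prod m z) as [l Hl].
    destruct (ex_cdiff_euler_factor m z) as [k Hk]. eexists.
    apply cdiff_mult; eassumption. }
  (* Each derivative is only known to exist; choice turns them into a sequence that can be
     summed. *)
  pose (l := fun m => proj1_sig (constructive_indefinite_description _ (HD m))).
  assert (Hl : forall m, cdiff (euler_diff m) z (l m)) by (intros m; apply proj2_sig).
  eexists. apply (cdiff_ext_loc (fun w => euler_prod 1 w + Cseries (fun m => euler_diff m w))).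
  { apply filter_forall. intros w. now rewrite rGamma_series. }
  apply cdiff_plus. exact H0.
  (* The disc of radius [r] about 0 contains the unit disc about [z]. *)
  pose (r := (Cmod z + 1)%R).
  apply (cdiff_Cseries euler_diff l z (Cseries (fun m => euler_diff m z))
           (fun m => 2 * Pbound r * ubound r * tel m)%R 1).
  - lra.
  - apply ex_series_tel.
  - apply is_series_euler_diff.
  - intros m w Hw. apply euler_diff_bounds; unfold r; [|lra].
    replace w with (z + (w - z)) by ring.
    eapply Rle_trans. apply Cmod_triangle. lra.
  - exact Hl.
Qed.

(** * Functional equation, special values and zeros of the reciprocal Gamma function *)

Lemma Cinv_neq_0 (z : C) : z <> 0 -> / z <> 0.
Proof.
  intros Hz E. pose proof (Cinv_r z Hz) as H. rewrite E, Cmult_0_r in H.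
  injection H. lra.
Qed.

Lemma poch_shift (z : C) (n : nat) : poch z (S n) = z * poch (z + 1) n.
Proof.
  induction n as [|n IH].
  - simpl. ring.
  - change (poch z (S (S n))) with (poch z (S n) * (z + RtoC (INR (S n)))).
    change (poch (z + 1) (S n)) with (poch (z + 1) n * (z + 1 + RtoC (INR n))).
    rewrite IH, S_INR, RtoC_plus. ring.
Qed.

Lemma poch_neq_0 (z : C) (n : nat) :
  (forall k : nat, z + RtoC (INR k) <> 0) -> poch z n <> 0.
Proof.
  intros H. induction n as [|n IH].
  - apply RtoC_neq_0. lra.
  - apply Cmult_neq_0; auto.
Qed.

Lemma poch_1 (n : nat) : poch 1 n = RtoC (INR (fact n)).
Proof.
  induction n as [|n IH]. reflexivity.
  change (poch 1 (S n)) with (poch 1 n * (1 + RtoC (INR n))).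
  change (fact (S n)) with (S n * fact n)%nat.
  rewrite IH, mult_INR, S_INR, RtoC_mult, RtoC_plus. ring.
Qed.

Lemma poch_2 (n : nat) : poch 2 n = RtoC (INR (fact (S n))).
Proof.
  rewrite <- poch_1, poch_shift. replace (1 + 1) with (RtoC 2). ring.
  rewrite <- RtoC_plus. reflexivity.
Qed.

Lemma Clim_inv_INR : Clim eventually (fun n => / RtoC (INR n)) 0.
Proof.
  apply Clim_eps. apply eventually_filter. intros eps He.
  destruct (nfloor_ex (/ eps)) as [N HN]. { left. now apply Rinv_0_lt_compat. }
  exists (S N). intros n Hn.
  assert (Hn' : (/ eps < INR n)%R).
  { apply Rlt_le_trans with (INR N + 1)%R. apply HN. rewrite <- S_INR. now apply le_INR. }
  assert (Hp : (0 < / eps)%R) by now apply Rinv_0_lt_compat.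
  replace (/ RtoC (INR n) - 0) with (/ RtoC (INR n)) by ring.
  rewrite Cmod_inv, Cmod_R, Rabs_pos_eq by (try apply RtoC_neq_0; lra).
  rewrite <- (Rinv_inv eps). apply Rinv_lt_contravar; auto.
  apply Rmult_lt_0_compat; lra.
Qed.

(** The approximants satisfy [z P_n(z+1) = P_n(z) (1 + (z+1)/n)] exactly, at the poles of [Gamma] as
    well. *)
Lemma rGamma_rec (z : C) : rGamma z = z * rGamma (z + 1).
Proof.
  apply (Clim_unique (F := eventually)
           (fun n => euler_prod n z * (1 + (z + 1) * / RtoC (INR n)))).
  - replace (rGamma z) with (rGamma z * (1 + (z + 1) * 0)) by ring.
    apply Clim_mult. apply euler_prod_Clim.
    apply Clim_plus. apply Clim_const. apply Clim_mult. apply Clim_const.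
    apply Clim_inv_INR.
  - apply (Clim_ext_loc (fun n => z * euler_prod n (z + 1))).
    + exists 1%nat. intros n Hn.
      assert (Hp : (0 < INR n)%R) by (apply lt_0_INR; lia).
      unfold euler_prod. rewrite Cpower_plus.
      rewrite (Cpower_pos (INR n) 1), Cmult_1_l, Cexp_RtoC, exp_ln by auto.
      transitivity (poch z (S (S n)) /
        (RtoC (INR (fact n)) * (Cpower (RtoC (INR n)) z * RtoC (INR n)))).
      { rewrite (poch_shift z (S n)). unfold Cdiv. ring. }
      change (poch z (S (S n))) with (poch z (S n) * (z + RtoC (INR (S n)))).
      rewrite S_INR, RtoC_plus. field. repeat split.
      apply RtoC_neq_0; lra. apply Cpower_neq_0. apply RtoC_fact_neq_0.
    + apply Clim_mult. apply Clim_const. apply euler_prod_Clim.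
Qed.

Lemma rGamma_0 : rGamma 0 = 0.
Proof. rewrite rGamma_rec. ring. Qed.

Lemma rGamma_1 : rGamma 1 = 1.
Proof.
  apply (Clim_unique (F := eventually) (fun n => euler_prod n 1)).
  - apply euler_prod_Clim.
  - apply (Clim_ext_loc (fun n => 1 + / RtoC (INR n))).
    + exists 1%nat. intros n Hn.
      assert (Hp : (0 < INR n)%R) by (apply lt_0_INR; lia).
      unfold euler_prod. rewrite poch_1, Cpower_pos, Cmult_1_l, Cexp_RtoC, exp_ln by auto.
      change (fact (S n)) with (S n * fact n)%nat.
      rewrite mult_INR, S_INR, RtoC_mult, RtoC_plus. field. split.
      apply RtoC_neq_0; lra. apply RtoC_fact_neq_0.
    + apply (Clim_eq _ (1 + 0)). ring.
      apply Clim_plus. apply Clim_const. apply Clim_inv_INR.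
Qed.

(** The functional equation is already a Caratheodory factorization at 0, with cofactor
    [rGamma (w + 1)]. *)
Lemma cdiff_rGamma_0 : cdiff rGamma 0 1.
Proof.
  exists (fun w => rGamma (w + 1)). split.
  - apply filter_forall. intros w. rewrite rGamma_0, (rGamma_rec w). ring.
  - apply (Clim_eq _ (rGamma 1) _ rGamma_1).
    apply (Clim_comp (fun w => w + 1) rGamma 1).
    + apply (Clim_eq _ (0 + 1)). ring.
      apply Clim_plus. apply Clim_nbhd_id. apply Clim_const.
    + destruct (ex_cdiff_rGamma 1) as [l Hl]. exact (cdiff_cont _ _ _ Hl).
Qed.

(** Past an [N] with [U / (N + 1) <= 1/2], the factors have modulus at least [1 - U * tel m]. Since
    [(1 - s)(1 - c) >= 1 - s - c] and the [tel m] telescope, their product stays above 1/2. The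
    approximant of index [N + 1] is nonzero by hypothesis, so the limit is too. *)
Lemma rGamma_neq_0 (z : C) :
  (forall k : nat, z + RtoC (INR k) <> 0) -> rGamma z <> 0.
Proof.
  intros Hz.
  pose (U := ubound (Cmod z)).
  assert (HU : (0 <= U)%R) by (apply ubound_pos, Cmod_ge_0).
  destruct (nfloor_ex (2 * U)) as [N HN]. lra.
  assert (HinvN : (U * / (INR N + 1) <= / 2)%R).
  { apply Rmult_le_reg_r with (INR N + 1)%R. pose proof (pos_INR N); lra.
    rewrite Rmult_assoc, Rinv_l, Rmult_1_r by (pose proof (pos_INR N); lra). lra. }
  assert (HPN : euler_prod (S N) z <> 0).
  { unfold euler_prod, Cdiv. apply Cmult_neq_0. now apply poch_neq_0.
    apply Cinv_neq_0. apply Cmult_neq_0. apply RtoC_fact_neq_0. apply Cpower_neq_0. }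
  apply Cmod_gt_0 in HPN. set (p := Cmod (euler_prod (S N) z)) in *.
  assert (H : forall k, (p * (1 - U * (/ (INR N + 1) - / (INR (N + k) + 1)))
                         <= Cmod (euler_prod (S (N + k)) z))%R).
  { induction k as [|k IH].
    - rewrite Nat.add_0_r. fold p. right. ring.
    - rewrite Nat.add_succ_r, euler_prod_rec, Cmod_mult.
      assert (Hu : (Cmod (euler_factor (N + k) z) <= U * tel (N + k))%R)
        by (apply euler_factor_Cmod_le; lra).
      assert (Hv : (1 - U * tel (N + k) <= Cmod (1 + euler_factor (N + k) z))%R).
      { pose proof (Cmod_triangle (1 + euler_factor (N + k) z) (- euler_factor (N + k) z)) as Ht.
        replace (1 + euler_factor (N + k) z + - euler_factor (N + k) z) with (RtoC 1) in Ht by ring.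
        rewrite Cmod_opp, Cmod_1 in Ht. lra. }
      pose proof (tel_pos (N + k)) as Htp.
      assert (Htl : (tel (N + k) <= / (INR N + 1))%R).
      { rewrite tel_eq. pose proof (pos_INR N). pose proof (pos_INR (S (N + k))).
        assert (0 < / (INR (S (N + k)) + 1))%R by (apply Rinv_0_lt_compat; lra).
        assert (/ (INR (N + k) + 1) <= / (INR N + 1))%R.
        { apply Rinv_le_contravar. lra. rewrite plus_INR. pose proof (pos_INR k). lra. }
        lra. }
      assert (Hc : (0 <= U * tel (N + k) <= / 2)%R) by nra.
      replace (/ (INR N + 1) - / (INR (S (N + k)) + 1))%R
        with (/ (INR N + 1) - / (INR (N + k) + 1) + tel (N + k))%R
        by (rewrite tel_eq; ring).
      set (s := (U * (/ (INR N + 1) - / (INR (N + k) + 1)))%R) in *.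
      set (c := (U * tel (N + k))%R) in *.
      assert (Hs : (0 <= s)%R).
      { unfold s. apply Rmult_le_pos; auto.
        assert (/ (INR (N + k) + 1) <= / (INR N + 1))%R.
        { apply Rinv_le_contravar. pose proof (pos_INR N); lra.
          rewrite plus_INR. pose proof (pos_INR k). lra. }
        lra. }
      apply Rle_trans with (p * (1 - s) * (1 - c))%R.
      + rewrite Rmult_assoc. apply Rmult_le_compat_l. lra.
        replace (U * (/ (INR N + 1) - / (INR (N + k) + 1) + tel (N + k)))%R
          with (s + c)%R by (unfold s, c; ring). nra.
      + apply Rle_trans with (Cmod (euler_prod (S (N + k)) z) * (1 - c))%R.
        * apply Rmult_le_compat_r; lra.
        * apply Rmult_le_compat_l; [apply Cmod_ge_0 | exact Hv]. }
  assert (Hlow : forall n, (S N <= n)%nat -> (p / 2 <= Cmod (euler_prod n z))%R).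
  { intros n Hn. replace n with (S (N + (n - S N))) by lia.
    eapply Rle_trans; [|apply H].
    assert (0 < / (INR (N + (n - S N)) + 1))%R.
    { apply Rinv_0_lt_compat. pose proof (pos_INR (N + (n - S N))). lra. }
    unfold Rdiv. apply Rmult_le_compat_l. lra. nra. }
  intros E. pose proof (euler_prod_Clim z) as HC. rewrite E in HC.
  rewrite Clim_eps in HC by apply eventually_filter.
  assert (Hp2 : (0 < p / 2)%R) by lra.
  destruct (HC _ Hp2) as [n0 Hn0].
  specialize (Hn0 (n0 + S N)%nat ltac:(lia)). specialize (Hlow (n0 + S N)%nat ltac:(lia)).
  replace (euler_prod (n0 + S N) z - 0) with (euler_prod (n0 + S N) z) in Hn0 by ring. lra.
Qed.

(** * Confluent hypergeometric series *)

Lemma Cmod_add_INR_ge (b : C) :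
  (forall k : nat, b + RtoC (INR k) <> 0) ->
  exists c, (0 < c)%R /\ forall k : nat, (c * (INR k + 1) <= Cmod (b + RtoC (INR k)))%R.
Proof.
  intros Hb.
  assert (Hfin : forall n, exists c, (0 < c)%R /\
    forall k, (k < n)%nat -> (c * (INR k + 1) <= Cmod (b + RtoC (INR k)))%R).
  { induction n as [|n [c [Hc IH]]].
    - exists 1%R. split. lra. intros k Hk. lia.
    - pose proof (proj1 (Cmod_gt_0 _) (Hb n)) as Hn. pose proof (pos_INR n) as Hp.
      exists (Rmin c (Cmod (b + RtoC (INR n)) / (INR n + 1))). split.
      + apply Rmin_pos; auto. apply Rdiv_lt_0_compat; lra.
      + intros k Hk. pose proof (pos_INR k).
        destruct (Nat.eq_dec k n) as [->|Hkn].
        * apply Rle_trans with (Cmod (b + RtoC (INR n)) / (INR n + 1) * (INR n + 1))%R.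
          apply Rmult_le_compat_r. lra. apply Rmin_r. right. field. lra.
        * eapply Rle_trans; [|apply IH; lia].
          apply Rmult_le_compat_r. lra. apply Rmin_l. }
  (* For [k > 2 * Cmod b + 1] the triangle inequality gives [Cmod (b + k) >= k - Cmod b >= (k + 1) /
     2]; the finitely many smaller [k] contribute a minimum. *)
  destruct (nfloor_ex (2 * Cmod b + 1)) as [N HN].
  { pose proof (Cmod_ge_0 b). lra. }
  destruct (Hfin (S N)) as [c [Hc H]].
  exists (Rmin c (/ 2)). split. apply Rmin_pos; lra.
  intros k. pose proof (pos_INR k).
  destruct (le_lt_dec (S N) k) as [Hk|Hk].
  - apply Rle_trans with (/ 2 * (INR k + 1))%R.
    apply Rmult_le_compat_r. lra. apply Rmin_r.
    apply le_INR in Hk. rewrite S_INR in Hk.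
    pose proof (Cmod_triangle (b + RtoC (INR k)) (- b)) as Ht.
    replace (b + RtoC (INR k) + - b) with (RtoC (INR k)) in Ht by ring.
    rewrite Cmod_opp, Cmod_R, Rabs_pos_eq in Ht by lra. lra.
  - eapply Rle_trans; [|apply H; lia]. apply Rmult_le_compat_r. lra. apply Rmin_l.
Qed.

(** Bounds consecutive quotients of [poch a n / poch b n] by [A / c] for all indices, so that one
    exponential series dominates Kummer's series for a whole neighbourhood of parameters. *)
Definition poch_growth (A c : R) (a b : C) : Prop :=
  forall k : nat, (Cmod (a + RtoC (INR k)) <= A * (INR k + 1))%R /\
                  (c * (INR k + 1) <= Cmod (b + RtoC (INR k)))%R.

Lemma poch_growth_near {T : Type} {F : (T -> Prop) -> Prop} {FF : Filter F}
  (f g : T -> C) (a b : C) :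
  Clim F f a -> Clim F g b -> (forall k : nat, b + RtoC (INR k) <> 0) ->
  exists A c, (0 < A)%R /\ (0 < c)%R /\ F (fun t => poch_growth A c (f t) (g t)).
Proof.
  rewrite !(Clim_eps F). intros Hf Hg Hb.
  destruct (Cmod_add_INR_ge b Hb) as [c [Hc H]].
  pose proof (Cmod_ge_0 a).
  (* Moving [b] by less than [c / 2] costs at most half of the bound [c * (INR k + 1)]. *)
  exists (Cmod a + 1)%R, (c / 2)%R. split; [lra|]. split; [lra|].
  assert (Hc2 : (0 < c / 2)%R) by lra.
  generalize (filter_and _ _ (Hf 1%R Rlt_0_1) (Hg _ Hc2)). apply filter_imp.
  intros t [H1 H2] k. pose proof (pos_INR k). split.
  - replace (f t + RtoC (INR k)) with ((f t - a) + (a + RtoC (INR k))) by ring.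
    eapply Rle_trans. apply Cmod_triangle.
    pose proof (Cmod_triangle a (RtoC (INR k))) as Ht.
    rewrite Cmod_R, Rabs_pos_eq in Ht by lra. nra.
  - pose proof (Cmod_triangle (g t + RtoC (INR k)) (- (g t - b))) as Ht.
    replace (g t + RtoC (INR k) + - (g t - b)) with (b + RtoC (INR k)) in Ht by ring.
    rewrite Cmod_opp in Ht. specialize (H k). nra.
Qed.

Lemma poch_growth_neq_0 (A c : R) (a b : C) (k : nat) :
  (0 < c)%R -> poch_growth A c a b -> b + RtoC (INR k) <> 0.
Proof.
  intros Hc H E. destruct (H k) as [_ H']. rewrite E, Cmod_0 in H'.
  pose proof (pos_INR k). nra.
Qed.

Lemma poch_div_Cmod_le (A c : R) (a b : C) (n : nat) :
  (0 < A)%R -> (0 < c)%R -> poch_growth A c a b ->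
  (Cmod (poch a n / poch b n) <= (A / c) ^ n)%R.
Proof.
  intros HA Hc H.
  assert (Hnz : forall k : nat, b + RtoC (INR k) <> 0)
    by (intros k; now apply (poch_growth_neq_0 A c a b k)).
  induction n as [|n IH].
  - simpl. unfold Cdiv. rewrite Cinv_r, Cmod_1 by (apply RtoC_neq_0; lra). lra.
  - change (poch a (S n)) with (poch a n * (a + RtoC (INR n))).
    change (poch b (S n)) with (poch b n * (b + RtoC (INR n))).
    replace (poch a n * (a + RtoC (INR n)) / (poch b n * (b + RtoC (INR n))))
      with ((a + RtoC (INR n)) / (b + RtoC (INR n)) * (poch a n / poch b n))
      by (field; split; auto; now apply poch_neq_0).
    rewrite Cmod_mult. simpl.
    apply Rmult_le_compat; auto using Cmod_ge_0.
    rewrite Cmod_div by auto. destruct (H n) as [H1 H2]. pose proof (pos_INR n).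
    pose proof (Cmod_ge_0 (a + RtoC (INR n))).
    replace (A / c)%R with ((A * (INR n + 1)) * / (c * (INR n + 1)))%R by (field; lra).
    apply Rmult_le_compat; auto. left. apply Rinv_0_lt_compat. nra.
    apply Rinv_le_contravar; auto. nra.
Qed.

Lemma ex_series_exp (y : R) : ex_series (fun n => y ^ n / INR (fact n))%R.
Proof.
  exists (exp y). pose proof (is_exp_Reals y) as H. revert H.
  unfold is_pseries. apply is_series_ext. intros n.
  rewrite pow_n_pow. reflexivity.
Qed.

Lemma Cmod_pow_div_fact (z : C) (n : nat) :
  Cmod (Cpow z n / RtoC (INR (fact n))) = (Cmod z ^ n / INR (fact n))%R.
Proof.
  rewrite Cmod_div by apply RtoC_fact_neq_0.
  now rewrite Cmod_pow, Cmod_R, Rabs_pos_eq by apply pos_INR.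
Qed.

Definition kummer_term (a b z : C) (n : nat) : C :=
  poch a n / poch b n * (Cpow z n / RtoC (INR (fact n))).

Lemma kummerM_eq (a b z : C) : kummerM a b z = Cseries (kummer_term a b z).
Proof.
  unfold kummerM, pFq. apply Cseries_ext. intros n. unfold pochs, kummer_term. simpl.
  now rewrite !Cmult_1_r.
Qed.

Lemma kummer_term_Cmod_le (A c : R) (a b z : C) (n : nat) :
  (0 < A)%R -> (0 < c)%R -> poch_growth A c a b ->
  (Cmod (kummer_term a b z n) <= (A / c * Cmod z) ^ n / INR (fact n))%R.
Proof.
  intros HA Hc H. unfold kummer_term. rewrite Cmod_mult, Cmod_pow_div_fact, Rpow_mult_distr.
  unfold Rdiv at 2. rewrite Rmult_assoc. apply Rmult_le_compat_r.
  - apply Rmult_le_pos. apply pow_le, Cmod_ge_0.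
    left. apply Rinv_0_lt_compat, INR_fact_lt_0.
  - now apply poch_div_Cmod_le.
Qed.

Lemma is_series_kummerM (a b z : C) :
  (forall k : nat, b + RtoC (INR k) <> 0) ->
  is_series (V := C_NormedModule) (kummer_term a b z) (kummerM a b z).
Proof.
  intros Hb. rewrite kummerM_eq.
  (* Constant families along an arbitrary proper filter: only the constants [A] and [c] are
     extracted. *)
  destruct (poch_growth_near (F := nbhd 0) _ _ a b (Clim_const _) (Clim_const _) Hb)
    as [A [c [HA [Hc HF]]]].
  destruct (filter_ex _ HF) as [_ HF'].
  eapply Cseries_correct.
  - intros m. now apply kummer_term_Cmod_le with (A := A) (c := c).
  - apply ex_series_exp.
Qed.

(* [kummerM a b z = 1 + a * kummerM_slope a b z], with no division by [a]. *)
Definition kummer_slope_term (a b z : C) (m : nat) : C :=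
  poch (a + 1) m / poch b (S m) * (Cpow z (S m) / RtoC (INR (fact (S m)))).

Definition kummerM_slope (a b z : C) : C := Cseries (kummer_slope_term a b z).

Lemma kummer_slope_term_Cmod_le (A c : R) (a b z : C) (m : nat) :
  (0 < A)%R -> (0 < c)%R -> poch_growth A c (a + 1) b ->
  (Cmod (kummer_slope_term a b z m)
   <= Cmod z / c * ((A / c * Cmod z) ^ m / INR (fact m)))%R.
Proof.
  intros HA Hc H. pose proof (pos_INR m) as Hm.
  pose proof (poch_growth_neq_0 A c _ b m Hc H) as Hnz.
  pose proof (Cmod_ge_0 z) as Hz.
  assert (Hpn : poch b m <> 0).
  { apply poch_neq_0. intros k. now apply (poch_growth_neq_0 A c (a + 1) b k). }
  replace (kummer_slope_term a b z m)
    with (z / (RtoC (INR (S m)) * (b + RtoC (INR m))) * kummer_term (a + 1) b z m).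
  - rewrite Cmod_mult. apply Rmult_le_compat; auto using Cmod_ge_0.
    + rewrite Cmod_div.
      2: { apply Cmult_neq_0; auto. apply RtoC_neq_0. rewrite S_INR. lra. }
      apply Rmult_le_compat_l; auto. rewrite Cmod_mult, Cmod_R, S_INR, Rabs_pos_eq by lra.
      apply Rinv_le_contravar; auto. destruct (H m) as [_ H2]. nra.
    + now apply kummer_term_Cmod_le.
  - unfold kummer_slope_term, kummer_term.
    change (poch b (S m)) with (poch b m * (b + RtoC (INR m))).
    change (fact (S m)) with (S m * fact m)%nat.
    rewrite mult_INR, RtoC_mult, Cpow_S. field. repeat split; auto.
    apply RtoC_fact_neq_0. apply RtoC_neq_0. rewrite S_INR. lra.
Qed.

Lemma is_series_kummer_slope (a b z : C) :
  (forall k : nat, b + RtoC (INR k) <> 0) ->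
  is_series (V := C_NormedModule) (kummer_slope_term a b z) (kummerM_slope a b z).
Proof.
  intros Hb.
  destruct (poch_growth_near (F := nbhd 0) _ _ (a + 1) b (Clim_const _) (Clim_const _) Hb)
    as [A [c [HA [Hc HF]]]].
  destruct (filter_ex _ HF) as [_ HF'].
  eapply Cseries_correct.
  - intros m. now apply kummer_slope_term_Cmod_le with (A := A) (c := c).
  - apply (ex_series_scal (Cmod z / c)%R _ (ex_series_exp _)).
Qed.

(** By [poch_shift], [poch a (S m)] is [a * poch (a + 1) m], so [a] factors out of every term after
    the first. *)
Lemma kummerM_split (a b z : C) :
  (forall k : nat, b + RtoC (INR k) <> 0) ->
  kummerM a b z = 1 + a * kummerM_slope a b z.
Proof.
  intros Hb. rewrite kummerM_eq. apply Cseries_unique.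
  pose proof (is_series_kummer_slope a b z Hb) as H.
  apply (is_series_scal (K := C_AbsRing) (V := C_NormedModule) a) in H.
  apply (is_series_decr_1 (V := C_NormedModule)).
  assert (E : a * kummerM_slope a b z = 1 + a * kummerM_slope a b z + - kummer_term a b z 0).
  { unfold kummer_term. simpl. field. }
  change (is_series (V := C_NormedModule) (fun m => kummer_term a b z (S m))
            (1 + a * kummerM_slope a b z + - kummer_term a b z 0)).
  rewrite <- E. revert H. apply is_series_ext. intros m.
  change (a * kummer_slope_term a b z m = kummer_term a b z (S m)).
  unfold kummer_slope_term, kummer_term. rewrite (poch_shift a). unfold Cdiv. ring.
Qed.

Lemma Clim_poch {T : Type} {F : (T -> Prop) -> Prop} {FF : Filter F}
  (f : T -> C) (a : C) (n : nat) :
  Clim F f a -> Clim F (fun t => poch (f t) n) (poch a n).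
Proof.
  intros Hf. induction n as [|n IH]; simpl.
  - apply Clim_const.
  - apply Clim_mult; auto. apply Clim_plus; auto. apply Clim_const.
Qed.

Section KummerContinuity.
Context {T : Type} {F : (T -> Prop) -> Prop} {FF : ProperFilter F}.
Variables (f g : T -> C) (a b z : C).
Hypotheses (Hf : Clim F f a) (Hg : Clim F g b)
  (Hb : forall k : nat, b + RtoC (INR k) <> 0).

Lemma Clim_kummerM : Clim F (fun t => kummerM (f t) (g t) z) (kummerM a b z).
Proof.
  destruct (poch_growth_near f g a b Hf Hg Hb) as [A [c [HA [Hc HF]]]].
  apply (Clim_ext_loc (fun t => Cseries (kummer_term (f t) (g t) z))).
  { apply filter_forall. intros t. symmetry. apply kummerM_eq. }
  rewrite kummerM_eq.
  apply (Clim_Cseries_dominated _ _ (fun n => (A / c * Cmod z) ^ n / INR (fact n))%R).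
  - apply ex_series_exp.
  - revert HF. apply filter_imp. intros t Ht n. now apply kummer_term_Cmod_le.
  - intros n. apply Clim_mult; [|apply Clim_const].
    apply Clim_mult. now apply Clim_poch. apply Clim_inv.
    now apply poch_neq_0. now apply Clim_poch.
Qed.

Lemma Clim_kummerM_slope :
  Clim F (fun t => kummerM_slope (f t) (g t) z) (kummerM_slope a b z).
Proof.
  assert (Hf1 : Clim F (fun t => f t + 1) (a + 1)).
  { apply Clim_plus; auto. apply Clim_const. }
  destruct (poch_growth_near (fun t => f t + 1) g (a + 1) b Hf1 Hg Hb)
    as [A [c [HA [Hc HF]]]].
  apply (Clim_Cseries_dominated (fun t => kummer_slope_term (f t) (g t) z) _
    (fun n => Cmod z / c * ((A / c * Cmod z) ^ n / INR (fact n)))%R).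
  - apply (ex_series_scal (Cmod z / c)%R _ (ex_series_exp _)).
  - revert HF. apply filter_imp. intros t Ht n. now apply kummer_slope_term_Cmod_le.
  - intros n. apply Clim_mult; [|apply Clim_const].
    apply Clim_mult. now apply Clim_poch. apply Clim_inv.
    now apply poch_neq_0. now apply Clim_poch.
Qed.

End KummerContinuity.

(** At [a = 0] the term has [poch 1 m] on top, [(m+1)!] is [poch 2 m], and [poch b (S m)] is
    [b * poch (b + 1) m]. *)
Lemma kummerM_slope_0 (b z : C) :
  (forall k : nat, b + RtoC (INR k) <> 0) ->
  z <> 0 -> kummerM_slope 0 b z = z / b * pFq [RtoC 1; RtoC 1] [b + 1; RtoC 2] z.
Proof.
  intros Hb Hz.
  assert (Hb0 : b <> 0).
  { specialize (Hb 0%nat). simpl in Hb. now rewrite Cplus_0_r in Hb. }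
  assert (Hb1 : forall k : nat, b + 1 + RtoC (INR k) <> 0).
  { intros k. specialize (Hb (S k)). rewrite S_INR, RtoC_plus in Hb.
    intros E. apply Hb. rewrite <- E. ring. }
  assert (E : forall m, kummer_slope_term 0 b z m = z / b *
    (pochs [RtoC 1; RtoC 1] m / pochs [b + 1; RtoC 2] m * (Cpow z m / RtoC (INR (fact m))))).
  { intros m. unfold kummer_slope_term, pochs. simpl fold_right.
    rewrite poch_shift, poch_2, Cpow_S, Cplus_0_l, poch_1. field.
    repeat split; auto using RtoC_fact_neq_0. now apply poch_neq_0. }
  (* Convergence of the 2F2 series is inherited from the slope series by scaling, which is why the
     identity is first inverted. *)
  assert (H : pFq [RtoC 1; RtoC 1] [b + 1; RtoC 2] z = b / z * kummerM_slope 0 b z).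
  { apply Cseries_unique.
    pose proof (is_series_scal (K := C_AbsRing) (V := C_NormedModule) (b / z) _ _
                  (is_series_kummer_slope 0 b z Hb)) as H.
    revert H. apply is_series_ext. intros m.
    change (b / z * kummer_slope_term 0 b z m = pochs [RtoC 1; RtoC 1] m
      / pochs [b + 1; RtoC 2] m * (Cpow z m / RtoC (INR (fact m)))).
    rewrite E. field. repeat split; auto using RtoC_fact_neq_0.
    unfold pochs. simpl. rewrite Cmult_1_r, poch_2.
    apply Cmult_neq_0. now apply poch_neq_0. apply RtoC_fact_neq_0. }
  rewrite H. field. auto.
Qed.

(** * The Whittaker function *)

Lemma is_Cint_opp (z : C) : is_Cint (- z) -> is_Cint z.
Proof.
  intros [k E]. exists (- k)%Z. rewrite opp_IZR, RtoC_opp, <- E. ring.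
Qed.

Lemma is_Cint_plus_IZR (z : C) (k : Z) : is_Cint (z + RtoC (IZR k)) -> is_Cint z.
Proof.
  intros [j E]. exists (j - k)%Z. rewrite minus_IZR, RtoC_minus, <- E. ring.
Qed.

Lemma not_is_Cint_neq_0 (z : C) (k : nat) : ~ is_Cint z -> z + RtoC (INR k) <> 0.
Proof.
  intros Hz E. apply Hz, (is_Cint_plus_IZR z (Z.of_nat k)).
  exists 0%Z. now rewrite <- INR_IZR_INZ.
Qed.

(** [Cmod_add_INR_ge] for [b] and for [- b] gives a positive distance to the integers of either
    sign. This keeps [tricomiU] on its non-integer branch near the point of differentiation. *)
Lemma not_is_Cint_near {T : Type} {F : (T -> Prop) -> Prop} {FF : Filter F}
  (f : T -> C) (b : C) :
  Clim F f b -> ~ is_Cint b -> F (fun t => ~ is_Cint (f t)).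
Proof.
  rewrite (Clim_eps F). intros Hf Hb.
  assert (Hb' : ~ is_Cint (- b)) by (intros H; now apply Hb, is_Cint_opp).
  destruct (Cmod_add_INR_ge b) as [c1 [Hc1 H1]].
  { intros k. now apply not_is_Cint_neq_0. }
  destruct (Cmod_add_INR_ge (- b)) as [c2 [Hc2 H2]].
  { intros k. now apply not_is_Cint_neq_0. }
  generalize (filter_and _ _ (Hf c1 Hc1) (Hf c2 Hc2)). apply filter_imp.
  intros t [B1 B2] [k E].
  destruct (Z.le_ge_cases 0 k) as [Hk|Hk].
  - specialize (H2 (Z.to_nat k)). pose proof (pos_INR (Z.to_nat k)).
    rewrite INR_IZR_INZ, Z2Nat.id in * by auto.
    replace (- b + RtoC (IZR k)) with (f t - b) in H2 by (rewrite E; ring). nra.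
  - specialize (H1 (Z.to_nat (- k))). pose proof (pos_INR (Z.to_nat (- k))).
    rewrite INR_IZR_INZ, Z2Nat.id in * by lia.
    replace (b + RtoC (IZR (- k))) with (- (f t - b)) in H1
      by (rewrite E, opp_IZR, RtoC_opp; ring).
    rewrite Cmod_opp in H1. nra.
Qed.

Lemma cdiff_Gamma (z l : C) :
  rGamma z <> 0 -> cdiff rGamma z l -> cdiff Gamma z (- l / (rGamma z * rGamma z)).
Proof. intros Hz Hl. exact (cdiff_inv rGamma z l Hz Hl). Qed.

Lemma digamma_eq (z l : C) :
  rGamma z <> 0 -> cdiff rGamma z l -> digamma z = - l / rGamma z.
Proof.
  intros Hz Hl. unfold digamma.
  rewrite (is_C_derive_unique _ _ _ (cdiff_is_derive _ _ _ (cdiff_Gamma z l Hz Hl))).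
  unfold Gamma. field. auto.
Qed.

Lemma Gamma_rec (z : C) : z <> 0 -> rGamma (z + 1) <> 0 -> Gamma (z + 1) = z * Gamma z.
Proof.
  intros Hz Hr. unfold Gamma. rewrite (rGamma_rec z). field. auto.
Qed.

(** The signs [(-1)^n] and [(-x)^n] combine to [x^n], and [1 / (p + n)] equals
    [poch p n / (p * poch (p + 1) n)]. *)
Lemma lower_gamma_neg (p : C) (x : R) :
  (0 < x)%R -> ~ is_Cint p ->
  lower_gamma p (RtoC (- x)) = Cpower (RtoC (- x)) p / p * kummerM p (p + 1) (RtoC x).
Proof.
  intros Hx Hp.
  assert (Hpk : forall k : nat, p + RtoC (INR k) <> 0)
    by (intros k; now apply not_is_Cint_neq_0).
  assert (Hp1 : forall k : nat, p + 1 + RtoC (INR k) <> 0).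
  { intros k E. apply (Hpk (S k)). rewrite S_INR, RtoC_plus, <- E. ring. }
  assert (Hp0 : p <> 0).
  { specialize (Hpk 0%nat). simpl in Hpk. now rewrite Cplus_0_r in Hpk. }
  unfold lower_gamma. apply Cseries_unique.
  pose proof (is_series_scal (K := C_AbsRing) (V := C_NormedModule)
    (Cpower (RtoC (- x)) p / p) _ _ (is_series_kummerM p (p + 1) (RtoC x) Hp1)) as H.
  revert H. apply is_series_ext. intros n.
  change (Cpower (RtoC (- x)) p / p * kummer_term p (p + 1) (RtoC x) n
    = Cpow (RtoC (-1)) n * Cpower (RtoC (- x)) (p + RtoC (INR n))
        / (RtoC (INR (fact n)) * (p + RtoC (INR n)))).
  rewrite Cpower_plus, Cpower_neg_INR by auto. unfold kummer_term.
  replace (RtoC x) with (RtoC (-1) * RtoC (- x)) by (rewrite <- RtoC_mult; f_equal; ring).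
  rewrite Cpow_mult_l.
  replace (poch p n) with (p * poch (p + 1) n / (p + RtoC (INR n))).
  - field. repeat split; auto using RtoC_fact_neq_0. now apply poch_neq_0.
  - rewrite <- poch_shift.
    change (poch p (S n)) with (poch p n * (p + RtoC (INR n))). field. auto.
Qed.

(** The function [F] of the overview. The argument [- (1) * nu + - mu] keeps the affine form
    expected by [cdiff_affine]. *)
Definition whittaker_half (mu : C) (x : R) (nu : C) : C :=
  Cpower (RtoC x) nu * (Gamma (- (2) * nu) * rGamma (- (1) * nu + - mu))
  * kummerM (nu - mu) (2 * nu + 1) (RtoC x).

(** The two Kummer solutions in [tricomiU_nonint] are exchanged by [nu -> - nu], once
    [x^nu * x^(-2 nu)] is merged into [x^(-nu)]. *)
Lemma whittakerW_eq (mu nu : C) (x : R) :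
  (0 < x)%R -> ~ is_Cint (2 * nu + 1) ->
  whittakerW (mu + RtoC (1 / 2)) nu x
  = RtoC (sqrt x) * RtoC (exp (- x / 2))
    * (whittaker_half mu x nu + whittaker_half mu x (- nu)).
Proof.
  intros Hx Hnu. unfold whittakerW, tricomiU, tricomiU_nonint, whittaker_half.
  replace (RtoC 1 + RtoC 2 * nu) with (2 * nu + 1) by ring.
  destruct excluded_middle_informative as [H|_]; [contradiction|].
  replace (RtoC (1 / 2) + nu - (mu + RtoC (1 / 2))) with (nu - mu) by ring.
  replace (RtoC 1 - (2 * nu + 1)) with (- (2) * nu) by ring.
  replace (nu - mu - (2 * nu + 1) + RtoC 1) with (- (1) * nu + - mu) by ring.
  replace (2 * nu + 1 - RtoC 1) with (- (2) * - nu) by ring.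
  replace (RtoC 2 - (2 * nu + 1)) with (2 * - nu + 1) by ring.
  replace (- (1) * - nu + - mu) with (nu - mu) by ring.
  replace (- nu - mu) with (- (1) * nu + - mu) by ring.
  replace (Cpower (RtoC x) (nu + RtoC (1 / 2))) with (Cpower (RtoC x) nu * RtoC (sqrt x)).
  2: { rewrite Cpower_plus. f_equal. rewrite Cpower_pos, <- RtoC_mult, Cexp_RtoC by auto.
       f_equal. rewrite <- Rpower_sqrt by auto. unfold Rpower. f_equal. field. }
  replace (Cpower (RtoC x) (- (2) * nu)) with (/ Cpower (RtoC x) nu * / Cpower (RtoC x) nu).
  2: { rewrite <- Cpower_opp, <- Cpower_plus. f_equal. ring. }
  rewrite (Cpower_opp _ nu). field. apply Cpower_neq_0.
Qed.

(** [kummerM_split] is a Caratheodory factorization here, so the moving lower parameter contributes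
    nothing to first order. *)
Lemma cdiff_kummerM_upper_zero (mu z : C) :
  ~ is_Cint (2 * mu + 1) ->
  cdiff (fun nu => kummerM (nu - mu) (2 * nu + 1) z) mu (kummerM_slope 0 (2 * mu + 1) z).
Proof.
  intros Hmu.
  assert (Hb : Clim (nbhd mu) (fun nu => 2 * nu + 1) (2 * mu + 1)).
  { exact (cdiff_cont _ _ _ (cdiff_affine 2 1 mu)). }
  exists (fun nu => kummerM_slope (nu - mu) (2 * nu + 1) z). split.
  - generalize (not_is_Cint_near _ _ Hb Hmu). apply filter_imp. intros nu Hnu.
    rewrite !kummerM_split by (intros k; now apply not_is_Cint_neq_0). ring.
  - apply Clim_kummerM_slope; auto.
    + apply (Clim_eq _ (mu - mu)). ring.
      apply Clim_minus. apply Clim_nbhd_id. apply Clim_const.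
    + intros k. now apply not_is_Cint_neq_0.
Qed.

Lemma cdiff_whittaker_half (mu : C) (x : R) :
  (0 < x)%R -> ~ is_Cint (2 * mu) ->
  cdiff (whittaker_half mu x) mu
    (Cpower (RtoC x) mu * (kummerM_slope 0 (2 * mu + 1) (RtoC x)
       - digamma (- (2 * mu)) + RtoC (ln x))).
Proof.
  intros Hx Hmu.
  assert (Hmu1 : ~ is_Cint (2 * mu + 1)).
  { intros H. apply Hmu. exact (is_Cint_plus_IZR _ 1 H). }
  assert (Hr : rGamma (- (2 * mu)) <> 0).
  { apply rGamma_neq_0. intros k. apply not_is_Cint_neq_0.
    intros H. now apply Hmu, is_Cint_opp. }
  destruct (ex_cdiff_rGamma (- (2 * mu))) as [l Hl].
  rewrite (digamma_eq _ l Hr Hl).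
  assert (E1 : - (2) * mu + 0 = - (2 * mu)) by ring.
  assert (E2 : - (1) * mu + - mu = - (2 * mu)) by ring.
  (* [Gamma (-2 nu)] contributes [-2 psi] and the reciprocal Gamma factor [+ psi], both at [-2 mu];
     their product at [mu] is 1, which leaves [- psi (-2 mu)]. *)
  assert (HG : cdiff (fun nu => Gamma (- (2) * nu + 0)) mu
    (- (2) * (- l / (rGamma (- (2 * mu)) * rGamma (- (2 * mu)))))).
  { apply (cdiff_comp Gamma (fun nu => - (2) * nu + 0)). apply cdiff_affine.
    rewrite E1. now apply cdiff_Gamma. }
  assert (Hrg : cdiff (fun nu => rGamma (- (1) * nu + - mu)) mu (- (1) * l)).
  { apply (cdiff_comp rGamma (fun nu => - (1) * nu + - mu)). apply cdiff_affine.
    now rewrite E2. }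
  pose proof (cdiff_mult _ _ _ _ _
    (cdiff_mult _ _ _ _ _ (cdiff_Cpower x mu Hx) (cdiff_mult _ _ _ _ _ HG Hrg))
    (cdiff_kummerM_upper_zero mu (RtoC x) Hmu1)) as H.
  cbv beta in H. rewrite E1, E2 in H.
  rewrite (kummerM_split _ (2 * mu + 1)) in H by (intros k; now apply not_is_Cint_neq_0).
  apply (cdiff_eq _ _ _ (Cpower (RtoC x) mu * (kummerM_slope 0 (2 * mu + 1) (RtoC x)
       - - l / rGamma (- (2 * mu)) + RtoC (ln x)))) in H.
  - revert H. apply cdiff_ext_loc. apply filter_forall. intros nu.
    unfold whittaker_half. now rewrite Cplus_0_r.
  - unfold Gamma. field. auto.
Qed.

Lemma cdiff_whittaker_half_opp (mu : C) (x : R) :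
  (0 < x)%R -> ~ is_Cint (2 * mu) ->
  cdiff (whittaker_half mu x) (- mu)
    (Gamma (2 * mu + 1) * Cpower (RtoC x) (- mu) * Cpower (RtoC (- x)) (2 * mu)
       * lower_gamma (- (2 * mu)) (RtoC (- x))).
Proof.
  intros Hx Hmu.
  assert (Hmu1 : ~ is_Cint (- (2 * mu))).
  { intros H. now apply Hmu, is_Cint_opp. }
  assert (Hmu2 : ~ is_Cint (- (2 * mu) + 1)).
  { intros H. apply Hmu1. exact (is_Cint_plus_IZR _ 1 H). }
  assert (Hmu0 : 2 * mu <> 0).
  { pose proof (not_is_Cint_neq_0 _ 0 Hmu) as H. simpl in H. now rewrite Cplus_0_r in H. }
  assert (Hmu3 : mu <> 0) by (intros E; apply Hmu0; rewrite E; ring).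
  assert (Hr : rGamma (2 * mu) <> 0).
  { apply rGamma_neq_0. intros k. now apply not_is_Cint_neq_0. }
  assert (Hr1 : rGamma (2 * mu + 1) <> 0).
  { intros E. apply Hr. rewrite rGamma_rec, E. ring. }
  destruct (ex_cdiff_rGamma (2 * mu)) as [l Hl].
  assert (E1 : - (2) * - mu = 2 * mu) by ring.
  pose (f := fun nu => Cpower (RtoC x) nu * Gamma (- (2) * nu)
               * kummerM (nu - mu) (2 * nu + 1) (RtoC x)).
  assert (Hf : Clim (nbhd (- mu)) f (f (- mu))).
  { unfold f. apply Clim_mult. apply Clim_mult.
    - exact (cdiff_cont _ _ _ (cdiff_Cpower x (- mu) Hx)).
    - apply (Clim_comp (fun nu => - (2) * nu) Gamma (- (2) * - mu)).
      + apply Clim_mult. apply Clim_const. apply Clim_nbhd_id.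
      + rewrite E1. exact (cdiff_cont _ _ _ (cdiff_Gamma _ _ Hr Hl)).
    - apply Clim_kummerM.
      + apply Clim_minus. apply Clim_nbhd_id. apply Clim_const.
      + exact (cdiff_cont _ _ _ (cdiff_affine 2 1 (- mu))).
      + intros k. apply not_is_Cint_neq_0.
        replace (2 * - mu + 1) with (- (2 * mu) + 1) by ring. exact Hmu2. }
  assert (E0 : - (1) * - mu + - mu = 0) by ring.
  assert (Hg : cdiff (fun nu => rGamma (- (1) * nu + - mu)) (- mu) (- (1) * 1)).
  { apply (cdiff_comp rGamma (fun nu => - (1) * nu + - mu)). apply cdiff_affine.
    rewrite E0. apply cdiff_rGamma_0. }
  assert (Hg0 : rGamma (- (1) * - mu + - mu) = 0) by (rewrite E0; apply rGamma_0).
  pose proof (cdiff_mult_zero f _ (- mu) _ Hf Hg0 Hg) as H.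
  apply (cdiff_ext_loc _ (whittaker_half mu x)) in H.
  2: { apply filter_forall. intros nu. unfold f, whittaker_half. ring. }
  revert H. apply cdiff_eq.
  (* The inner derivative -1 times [Gamma (2 mu)] matches [Gamma (2 mu + 1)] times the factor
     [1 / (-2 mu)] of the incomplete gamma function; the powers of [-x] cancel. *)
  unfold f. rewrite E1, lower_gamma_neg, Gamma_rec, !Cpower_opp by auto.
  replace (- mu - mu) with (- (2 * mu)) by ring.
  replace (2 * - mu + 1) with (- (2 * mu) + 1) by ring.
  field. repeat split; auto using Cpower_neq_0.
Qed.

(** Exchanging [z] with [- z] swaps [l] and [m], which gives the opposite signs at [mu] and
    [- mu]. *)
Lemma cdiff_reflect (f : C -> C) (z l m c : C) :
  cdiff f z l -> cdiff f (- z) m -> cdiff (fun w => c * (f w + f (- w))) z (c * (l - m)).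
Proof.
  intros Hl Hm.
  assert (H : cdiff (fun w => f (- (1) * w + 0)) z (- (1) * m)).
  { apply (cdiff_comp f (fun w => - (1) * w + 0)). apply cdiff_affine.
    now replace (- (1) * z + 0) with (- z) by ring. }
  pose proof (cdiff_mult _ _ _ _ _ (cdiff_const c z) (cdiff_plus _ _ _ _ _ Hl H)) as H'.
  apply (cdiff_eq _ _ _ (c * (l - m))) in H'; [|ring].
  revert H'. apply cdiff_ext_loc. apply filter_forall. intros w.
  do 2 f_equal. f_equal. ring.
Qed.

Theorem theorem6 (mu : C) (x s : R)
  (hmu : ~ is_Cint (RtoC 2 * mu)%C) (hx : (0 < x)%R)
  (hs : s = 1%R \/ s = (-1)%R) :
  is_derive (K := C_AbsRing) (V := C_NormedModule)
    (fun nu : C => whittakerW (mu + RtoC (1 / 2)) nu x)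
    (RtoC s * mu)%C
    (RtoC s * RtoC (sqrt x) * RtoC (exp (- x / 2)) *
      (Cpower (RtoC x) mu *
         (RtoC x / (RtoC 2 * mu + RtoC 1)
            * pFq [RtoC 1; RtoC 1] [RtoC 2 * mu + RtoC 2; RtoC 2] (RtoC x)
          - digamma (- (RtoC 2 * mu))
          + RtoC (ln x))
       - Gamma (RtoC 2 * mu + RtoC 1) * Cpower (RtoC x) (- mu)
         * Cpower (RtoC (- x)) (RtoC 2 * mu)
         * lower_gamma (- (RtoC 2 * mu)) (RtoC (- x))))%C.
Proof.
  apply cdiff_is_derive.
  assert (Hm1 : RtoC (-1) = - (1)) by exact (RtoC_opp 1).
  pose proof (cdiff_whittaker_half mu x hx hmu) as H1.
  pose proof (cdiff_whittaker_half_opp mu x hx hmu) as H2.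
  assert (Hmu1 : ~ is_Cint (2 * mu + 1)).
  { intros H. apply hmu. exact (is_Cint_plus_IZR _ 1 H). }
  rewrite kummerM_slope_0 in H1.
  2: { intros k. now apply not_is_Cint_neq_0. }
  2: { apply RtoC_neq_0. lra. }
  replace (2 * mu + 1 + 1) with (RtoC 2 * mu + RtoC 2) in H1.
  2: { replace (RtoC 2) with (RtoC 1 + RtoC 1) at 2 by (rewrite <- RtoC_plus; reflexivity). ring. }
  apply (cdiff_ext_loc (fun nu => RtoC (sqrt x) * RtoC (exp (- x / 2))
    * (whittaker_half mu x nu + whittaker_half mu x (- nu)))).
  (* The connection formula must hold on a whole neighbourhood of the point, and [2 * nu + 1] stays
     off the integers there for either sign. *)
  { assert (Hb : Clim (nbhd (RtoC s * mu)) (fun nu => 2 * nu + 1) (2 * (RtoC s * mu) + 1)).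
    { exact (cdiff_cont _ _ _ (cdiff_affine 2 1 (RtoC s * mu))). }
    apply not_is_Cint_near in Hb.
    - revert Hb. apply filter_imp. intros nu Hnu. symmetry. now apply whittakerW_eq.
    - intros H. apply (is_Cint_plus_IZR _ 1) in H. apply hmu.
      destruct hs as [-> | ->].
      + now rewrite Cmult_1_l in H.
      + apply is_Cint_opp. replace (- (2 * mu)) with (2 * (RtoC (-1) * mu)); auto.
        rewrite Hm1. ring. }
  destruct hs as [-> | ->].
  - rewrite !Cmult_1_l. now apply cdiff_reflect.
  - replace (RtoC (-1) * mu) with (- mu) by (rewrite Hm1; ring).
    (* At [- mu] the two one-sided results enter in reverse order, which produces the factor -1. *)
    eapply cdiff_eq; [|apply cdiff_reflect; [exact H2|]].
    2: { replace (- - mu) with mu by ring. exact H1. }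
    rewrite Hm1. ring.
Qed.
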